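(* Let $n\ge 1$, $\mathbf{r}=(r_1,\dots,r_n)\in D_n$, and let $\mathcal{X}\subset\mathcal{M}_1(\Gamma_{\mathbf{r}}\backslash\mathbb{H}_n)$ be a subset. The following are equivalent. (i) There are constants $C_1,C_2,C_3>0$ such that every $[\mathbf{A}]\in\mathcal{X}$ satisfies: (A-1) $\min\{\|X\|_{\mathbf{A}} : X\in\mathfrak{z}_{\mathbf{r}}\setminus\{0\}\}\ge C_1$; (A-2) $|\det(\tilde{\mathbf{A}})|\ge C_2$; (A-3) $d_n(\mathbf{A})\le C_3$. (ii) There are constants $D,V>0$ such that every $[\mathbf{A}]\in\mathcal{X}$ satisfies: (1) $\mathrm{diam}(\Gamma_{\mathbf{r}}\backslash\mathbb{H}_n,\mathfrak{v},\langle\cdot,\cdot\rangle_{\mathbf{A}})\le D$; (2) $\mathrm{meas}(\Gamma_{\mathbf{r}}\backslash\mathbb{H}_n,\mathfrak{v},\langle\cdot,\cdot\rangle_{\mathbf{A}})\ge V$, where $\mathrm{meas}$ is the total Popp measure.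
   Context: $\mathbb{H}_n$ is the Heisenberg group of dimension $2n+1$: its Lie algebra $\mathfrak{h}_n$ has basis $X_1,\dots,X_n,Y_1,\dots,Y_n,Z$ with $[X_i,Y_i]=Z$ and all other brackets of basis elements zero; $\mathbb{H}_n$ is identified with $\mathfrak{h}_n$ via $\exp$. Put $\mathfrak{v}=\mathrm{Span}\{X_1,\dots,X_n,Y_1,\dots,Y_n\}$. Endomorphisms of $\mathfrak{h}_n$ are written as matrices in this basis. $\langle\cdot,\cdot\rangle_0$ is the scalar product making the basis orthonormal. $D_n$ is the set of $n$-tuples of positive integers with $r_i\mid r_{i+1}$ for all $i$. $\Gamma_{\mathbf{r}}<\mathbb{H}_n$ is the lattice generated by $\exp(r_1X_1),\dots,\exp(r_nX_n),\exp(Y_1),\dots,\exp(Y_n),\exp(Z)$, and $\mathfrak{z}_{\mathbf{r}}\subset\mathfrak{v}$ is its image under the projection $\mathbb{H}_n\simeq\mathfrak{h}_n\to\mathfrak{v}$ (killing $Z$), a lattice in $\mathfrak{v}$. A pair $(\tilde{\mathbf{A}},0)\in\mathrm{GL}_{2n}(\mathbb{R})\times\{0\}$ is identified with the block matrix $\mathbf{A}=\begin{pmatrix}\tilde{\mathbf{A}}&0\\0&0\end{pmatrix}$. It defines the left invariant sub-Riemannian metric of corank $1$ on $\mathbb{H}_n$ given by the left translates of $\mathfrak{v}$ and of the scalar product $\langle U,V\rangle_{\mathbf{A}}=\langle\tilde{\mathbf{A}}^{-1}U,\tilde{\mathbf{A}}^{-1}V\rangle_0$ on $\mathfrak{v}$,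 with norm $\|\cdot\|_{\mathbf{A}}$; it descends to $\Gamma_{\mathbf{r}}\backslash\mathbb{H}_n$. The distance is the infimum of lengths of absolutely continuous paths tangent a.e. to the distribution. The moduli space is the double coset space $\mathcal{M}_1(\Gamma_{\mathbf{r}}\backslash\mathbb{H}_n)=\Pi_{\mathbf{r}}\backslash(\mathrm{GL}_{2n}(\mathbb{R})\times\{0\})/(\mathrm{O}(2n)\times\{\pm1\})$. Here $\mathbf{J}_n=\begin{pmatrix}0&\mathbf{I}_n\\-\mathbf{I}_n&0\end{pmatrix}$, $\widetilde{\mathrm{Sp}}(2n,\mathbb{R})=\{\mathbf{S}\in \mathrm{GL}_{2n}(\mathbb{R}):{}^t\mathbf{S}\mathbf{J}_n\mathbf{S}=\epsilon(\mathbf{S})\mathbf{J}_n,\ \epsilon(\mathbf{S})=\pm1\}$, $G_{\mathbf{r}}=\mathbf{diag}(\mathbf{r})\,\mathrm{GL}_{2n}(\mathbb{Z})\,\mathbf{diag}(\mathbf{r})^{-1}$ with $\mathbf{diag}(\mathbf{r})=\mathrm{diag}(r_1,\dots,r_n,1,\dots,1)$, and $\Pi_{\mathbf{r}}=\left\{\begin{pmatrix}\mathbf{S}&0\\0&\epsilon(\mathbf{S})\end{pmatrix}:\mathbf{S}\in G_{\mathbf{r}}\cap\widetilde{\mathrm{Sp}}(2n,\mathbb{R})\right\}$; the groups act by block matrix multiplication. $[\mathbf{A}]$ denotes the class of $\mathbf{A}$. The numbers $0<d_1(\mathbf{A})\le\dots\le d_n(\mathbf{A})$ are such that $\pm\sqrt{-1}\,d_1(\mathbf{A}),\dots,\pm\sqrt{-1}\,d_n(\mathbf{A})$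 are the eigenvalues of the operator $j_{\mathbf{A}}:\mathfrak{v}\to\mathfrak{v}$ defined by $\langle j_{\mathbf{A}}(U),V\rangle_{\mathbf{A}}=\omega([U,V])$ for $U,V\in\mathfrak{v}$, where $\omega$ is the covector with $\omega(Z)=1$, $\ker\omega=\mathfrak{v}$ (equivalently, the eigenvalues of ${}^t\tilde{\mathbf{A}}\mathbf{J}_n\tilde{\mathbf{A}}$). All quantities in (i) and (ii) depend only on $[\mathbf{A}]$. Popp's volume (corank $1$): if $U_1,\dots,U_{2n}$ is a left invariant orthonormal frame of $\mathfrak{v}$, completed by a left invariant field $U_{2n+1}$ to a frame with dual coframe $\nu^1,\dots,\nu^{2n+1}$, and $c_{ij}$ is the $U_{2n+1}$-component of $[U_i,U_j]$, then $\mathrm{dvol}_{sR}=\big(\sum_{i,j=1}^{2n}c_{ij}^2\big)^{-1/2}\,\nu^1\wedge\cdots\wedge\nu^{2n+1}$ (up to sign, independent of choices). The total Popp measure is $\left|\int_{\Gamma_{\mathbf{r}}\backslash\mathbb{H}_n}\mathrm{dvol}_{sR}\right|$. *)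

(* Defs.v *)
From HB Require Import structures.
From mathcomp Require Import all_boot all_order all_algebra.
From mathcomp Require Import complex ring lra zify.
From mathcomp Require Import all_classical all_reals all_analysis.

Set Implicit Arguments.
Unset Strict Implicit.
Unset Printing Implicit Defensive.

Import Order.TTheory GRing.Theory Num.Theory.
Import numFieldNormedType.Exports.

Local Open Scope classical_set_scope.
Local Open Scope ring_scope.

(* Conventions.  The Lie algebra h_n is 'cV[R]_(n + n + 1), coordinates with
   respect to the basis X_1..X_n, Y_1..Y_n, Z in this order; the group H_n is
   the same type (exp is the identity).  The subspace v is identified with
   'cV[R]_(n + n); matrices act on columns from the left. *)

Section Heisenberg.
Variables (R : realType) (n : nat).

Local Notation heis := 'cV[R]_(n + n + 1).

Definition iX (i : 'I_n) : 'I_(n + n + 1) := lshift 1 (lshift n i).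
Definition iY (i : 'I_n) : 'I_(n + n + 1) := lshift 1 (rshift n i).
Definition iZ : 'I_(n + n + 1) := rshift (n + n) ord0.

Definition basisX (i : 'I_n) : heis := delta_mx (iX i) 0.
Definition basisY (i : 'I_n) : heis := delta_mx (iY i) 0.
Definition basisZ : heis := delta_mx iZ 0.

Definition bracket (x y : heis) : heis :=
  (\sum_(i < n) (x (iX i) 0 * y (iY i) 0 - x (iY i) 0 * y (iX i) 0))
    *: basisZ.

Definition omega (x : heis) : R := x iZ 0.

Definition vproj (x : heis) : 'cV[R]_(n + n) := usubmx x.
Definition vincl (u : 'cV[R]_(n + n)) : heis := col_mx u 0.
Definition vdistr : set heis := [set x | omega x = 0].

(* Baker-Campbell-Hausdorff: exp x exp y = exp (x + y + [x, y] / 2). *)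
Definition hmul (x y : heis) : heis := x + y + 2^-1 *: bracket x y.
Definition hinv (x : heis) : heis := - x.

(* The differential of the left translation by g; see derive_hmul. *)
Definition dleft (g u : heis) : heis := u + 2^-1 *: bracket g u.

Definition is_subgroup (G : set heis) : Prop :=
  [/\ G 0, forall x y, G x -> G y -> G (hmul x y)
    & forall x, G x -> G (hinv x)].

Definition Dtuple (r : 'I_n -> nat) : Prop :=
  (forall i, (0 < r i)%N) /\
  (forall i j : 'I_n, j = i.+1 :> nat -> (r i %| r j)%N).

Definition Gamma (r : 'I_n -> nat) : set heis :=
  smallest is_subgroup
    ([set (r i)%:R *: basisX i | i in [set: 'I_n]] `|`
     [set basisY i | i in [set: 'I_n]] `|` [set basisZ]).

Definition zlattice (r : 'I_n -> nat) : set 'cV[R]_(n + n) :=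
  vproj @` Gamma r.

Definition dotprod m (u v : 'cV[R]_m) : R := \sum_i u i 0 * v i 0.

Definition scalA (A : 'M[R]_(n + n)) (u v : 'cV[R]_(n + n)) : R :=
  dotprod (invmx A *m u) (invmx A *m v).

Definition normA (A : 'M[R]_(n + n)) (u : 'cV[R]_(n + n)) : R :=
  Num.sqrt (scalA A u u).

Definition is_minimum (S : set R) (m : R) : Prop := S m /\ lbound S m.

Definition GL0 : set 'M[R]_(n + n + 1) :=
  [set block_mx A 0 0 0 | A in [set A : 'M[R]_(n + n) | A \in unitmx]].

Definition Jn : 'M[R]_(n + n) := block_mx 0 1%:M (- 1%:M) 0.

Definition diagr (r : 'I_n -> nat) : 'M[R]_(n + n) :=
  diag_mx (row_mx (\row_(i < n) (r i)%:R) (const_mx 1)).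

Definition Ggroup (r : 'I_n -> nat) : set 'M[R]_(n + n) :=
  [set diagr r *m map_mx intr P *m invmx (diagr r)
     | P in [set P : 'M[int]_(n + n) | P \in unitmx]].

Definition Pigroup (r : 'I_n -> nat) : set 'M[R]_(n + n + 1) :=
  [set M | exists (S : 'M[R]_(n + n)) (e : R),
    [/\ S \in unitmx, Ggroup r S, e = 1 \/ e = - 1,
        S^T *m Jn *m S = e *: Jn & M = block_mx S 0 0 e%:M]].

Definition Ogroup : set 'M[R]_(n + n + 1) :=
  [set M | exists (Q : 'M[R]_(n + n)) (e : R),
    [/\ Q^T *m Q = 1%:M, e = 1 \/ e = - 1 & M = block_mx Q 0 0 e%:M]].

Definition moduli_class (r : 'I_n -> nat) (M : 'M[R]_(n + n + 1)) :
    set 'M[R]_(n + n + 1) :=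
  [set P *m M *m Q | P in Pigroup r & Q in Ogroup].

Definition moduli (r : 'I_n -> nat) : set (set 'M[R]_(n + n + 1)) :=
  moduli_class r @` GL0.

Definition is_jA (A j : 'M[R]_(n + n)) : Prop :=
  forall u v, scalA A (j *m u) v = omega (bracket (vincl u) (vincl v)).

(* The eigenvalues of j_A are listed with (algebraic) multiplicity. *)
Definition is_dtuple (A : 'M[R]_(n + n)) (d : n.-tuple R) : Prop :=
  [/\ sorted <=%R d, all (fun x => 0 < x) d
    & exists2 j, is_jA A j &
      char_poly (map_mx (real_complex R) j) =
      \prod_(k < n) (('X - (Complex 0 (tnth d k))%:P) *
                     ('X - (Complex 0 (- tnth d k))%:P))].

Definition abs_continuous01 (c : R -> heis) : Prop :=
  forall eps : R, 0 < eps -> exists2 delta : R, 0 < delta &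
    forall (m : nat) (a b : 'I_m -> R),
      (forall i, 0 <= a i /\ a i <= b i /\ b i <= 1) ->
      trivIset [set: 'I_m] (fun i => `]a i, b i[%classic) ->
      \sum_i (b i - a i) < delta ->
      \sum_i `|c (b i) - c (a i)| < eps.

(* The velocity at time t, translated back to the Lie algebra. *)
Definition body_velocity (c : R -> heis) (t : R) : heis :=
  dleft (hinv (c t)) (derive1 c t).

(* Differentiability a.e. is implied by absolute continuity; it is repeated
   because derive1 is a total function. *)
Definition horizontal (c : R -> heis) : Prop :=
  abs_continuous01 c /\
  {ae (@lebesgue_measure R), forall t, t \in `[0, 1] ->
     derivable c t 1 /\ vdistr (body_velocity c t)}.

Definition path_length (A : 'M[R]_(n + n)) (c : R -> heis) : \bar R :=
  (\int[@lebesgue_measure R]_(t in `[0%R, 1%R])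
     (normA A (vproj (body_velocity c t)))%:E)%E.

Definition horbit (r : 'I_n -> nat) (g : heis) : set heis :=
  [set hmul gamma g | gamma in Gamma r].

Definition quotient (r : 'I_n -> nat) : set (set heis) := range (horbit r).

(* H_n -> Gamma_r \ H_n is a covering and a local isometry, so the horizontal
   paths of the quotient are the projections horbit r \o c of the horizontal
   paths c of H_n, with the same length. *)
Definition quotient_dist (r : 'I_n -> nat) (A : 'M[R]_(n + n))
    (p q : set heis) : \bar R :=
  ereal_inf [set path_length A c | c in
    [set c | [/\ horizontal c, horbit r (c 0) = p & horbit r (c 1) = q]]].

Definition diam (r : 'I_n -> nat) (A : 'M[R]_(n + n)) : \bar R :=
  ereal_sup [set quotient_dist r A p q | p in quotient r & q in quotient r].

(* The columns of U are the values at the identity of a left invariant frame,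
   whose first 2n fields form an orthonormal frame of v. *)
Definition adapted_frame (A : 'M[R]_(n + n)) (U : 'M[R]_(n + n + 1)) : Prop :=
  [/\ U \in unitmx,
      forall i : 'I_(n + n), vdistr (col (lshift 1 i) U)
    & forall i k : 'I_(n + n),
        scalA A (vproj (col (lshift 1 i) U)) (vproj (col (lshift 1 k) U)) =
        (i == k)%:R].

Definition structure_const (U : 'M[R]_(n + n + 1)) (i k : 'I_(n + n)) : R :=
  (invmx U *m bracket (col (lshift 1 i) U) (col (lshift 1 k) U)) iZ 0.

Definition frame_at (U : 'M[R]_(n + n + 1)) (g : heis) : 'M[R]_(n + n + 1) :=
  \matrix_(i, k) dleft g (col k U) i 0.

(* dvol_sR = popp_density U * dx_1 /\ ... /\ dy_n /\ dz: the dual coframe at g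
   is given by the rows of the inverse of the matrix of the frame at g. *)
Definition popp_density (U : 'M[R]_(n + n + 1)) (g : heis) : R :=
  (Num.sqrt (\sum_i \sum_k structure_const U i k ^+ 2))^-1 *
  \det (invmx (frame_at U g)).

End Heisenberg.

(* The Lebesgue integral over R^m as an iterated integral; only used for
   Borel functions of constant sign (Tonelli). *)
Fixpoint lebesgue_int (R : realType) (m : nat) :
    ('cV[R]_m -> \bar R) -> \bar R :=
  match m with
  | 0 => fun f => f 0
  | m'.+1 => fun f =>
      (\int[@lebesgue_measure R]_t
         lebesgue_int (fun x : 'cV[R]_m' => f (col_mx (t%:M : 'cV_1) x)))%E
  end.

Section Measure.
Variables (R : realType) (n : nat).

Local Notation heis := 'cV[R]_(n + n + 1).

(* A strict fundamental domain of Gamma_r acting by left translations; see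
   fund_domainP. *)
Definition fund_domain (r : 'I_n -> nat) : set heis :=
  [set x | (forall i, 0 <= x (iX i) 0 < (r i)%:R) /\
           (forall i, 0 <= x (iY i) 0 < 1) /\ 0 <= x (iZ n) 0 < 1].

Definition quotient_int (r : 'I_n -> nat) (f : heis -> R) : \bar R :=
  lebesgue_int (fun x => (f x * \1_(fund_domain r) x)%:E).

Definition is_popp_meas (r : 'I_n -> nat) (A : 'M[R]_(n + n)) (m : \bar R) :
    Prop :=
  exists2 U, adapted_frame A U & m = `| quotient_int r (popp_density U) |%E.

End Measure.

Section Lemmas.
Variables (R : realType) (n : nat).

Local Notation heis := 'cV[R]_(n + n + 1).
Implicit Types (x y g u : heis) (r : 'I_n -> nat).

Lemma bracketX x y i : bracket x y (iX i) 0 = 0.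
Proof. by rewrite !mxE eqxx andbT eq_lrshift mulr0. Qed.

Lemma bracketY x y i : bracket x y (iY i) 0 = 0.
Proof. by rewrite !mxE eqxx andbT eq_lrshift mulr0. Qed.

Lemma bracketDr g u x (h : R) :
  bracket g (h *: u + x) = h *: bracket g u + bracket g x.
Proof.
rewrite /bracket scalerA -scalerDl mulr_sumr -big_split /=.
congr (_ *: _); apply: eq_bigr => i _.
by rewrite !mxE; ring.
Qed.

Lemma derive_hmul g x u : 'D_u (hmul g) x = dleft g u.
Proof.
have affine (h : R) : hmul g (h *: u + x) - hmul g x = h *: dleft g u.
  rewrite /hmul /dleft bracketDr; apply/matrixP => i j.
  rewrite ![in LHS]mxE ![in RHS]mxE.
  move: (bracket g u i j) (bracket g x i j) => *; ring.
apply: cvg_lim; first exact: norm_hausdorff.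
apply: cvg_near_cst; near=> h.
rewrite affine scalerA mulVf ?scale1r //.
by near: h; exact: nbhs_dnbhs_neq.
Unshelve. all: by end_near. Qed.

Lemma Gamma_subgroup r : is_subgroup (Gamma (R := R) r).
Proof.
split=> [M [[]] //|x y Gx Gy M|x Gx M] SM; have [[M0 MM MV] _] := SM.
  by apply: MM; [exact: Gx|exact: Gy].
by apply: MV; exact: Gx.
Qed.

Let latt r x := [/\ forall i, x (iX i) 0 / (r i)%:R \is a Num.int,
  forall i, x (iY i) 0 \is a Num.int &
  x (iZ n) 0 - 2^-1 * (\sum_i x (iX i) 0 * x (iY i) 0) \is a Num.int].

Let eXY (i j : 'I_n) : (iX i == iY j) = false.
Proof. by rewrite (inj_eq (@lshift_inj _ _)) eq_lrshift. Qed.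

Let eYX (i j : 'I_n) : (iY i == iX j) = false.
Proof. by rewrite eq_sym eXY. Qed.

Let eXX (i j : 'I_n) : (iX i == iX j) = (i == j).
Proof. by rewrite !(inj_eq (@lshift_inj _ _)). Qed.

Let eYY (i j : 'I_n) : (iY i == iY j) = (i == j).
Proof. by rewrite (inj_eq (@lshift_inj _ _)) (inj_eq (@rshift_inj _ _)). Qed.

Let eXZ (i : 'I_n) : (iX i == iZ n) = false.
Proof. by rewrite eq_lrshift. Qed.

Let eYZ (i : 'I_n) : (iY i == iZ n) = false.
Proof. by rewrite eq_lrshift. Qed.

Let eZX (i : 'I_n) : (iZ n == iX i) = false.
Proof. by rewrite eq_sym eXZ. Qed.

Let eZY (i : 'I_n) : (iZ n == iY i) = false.
Proof. by rewrite eq_sym eYZ. Qed.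

Let eE := (eXY, eYX, eXX, eYY, eXZ, eYZ, eZX, eZY, eqxx, andbT).

Let hmulX x y i : hmul x y (iX i) 0 = x (iX i) 0 + y (iX i) 0.
Proof. by rewrite !mxE !eE !mulr0 addr0. Qed.

Let hmulY x y i : hmul x y (iY i) 0 = x (iY i) 0 + y (iY i) 0.
Proof. by rewrite !mxE !eE !mulr0 addr0. Qed.

Let hmulZ x y : hmul x y (iZ n) 0 = x (iZ n) 0 + y (iZ n) 0 + 2^-1 *
  \sum_(i < n) (x (iX i) 0 * y (iY i) 0 - x (iY i) 0 * y (iX i) 0).
Proof. by rewrite !mxE !eE mulr1. Qed.

Let lattX r x : (forall i, (0 < r i)%N) -> latt r x ->
  forall i, x (iX i) 0 \is a Num.int.
Proof.
move=> r0 [xX _ _] i; have := xX i.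
move=> /(fun h => rpredM h (natr_int R (r i))).
by rewrite divfK // pnatr_eq0 -lt0n.
Qed.

Let Gamma_latt r : (forall i, (0 < r i)%N) -> Gamma r `<=` latt r.
Proof.
move=> r0; apply: smallest_sub; last first.
  have r_neq0 i : (r i)%:R != 0 :> R by rewrite pnatr_eq0 -lt0n.
  move=> x [[[i _ <-]|[i _ <-]]|->]; split=> [j|j|]; rewrite ?mxE ?eE ?mulr0 ?mul0r ?int_num0 //.
  - case: eqVneq => [->|_]; first by rewrite mulr1 divff ?int_num1.
    by rewrite mulr0 mul0r int_num0.
  - rewrite big1 => [|j _]; last by rewrite !mxE !eE ?mul0r ?mulr0.
    by rewrite mulr0 subr0.
  - rewrite big1 => [|j _]; last by rewrite !mxE !eE ?mul0r ?mulr0.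
    by rewrite mulr0 subr0.
  - rewrite big1 => [|j _]; last by rewrite !mxE !eE ?mul0r ?mulr0.
    by rewrite mulr0 subr0.
split=> [|x y Lx Ly|x Lx].
- split=> [i|i|]; rewrite ?mxE ?mul0r ?int_num0 //.
  by rewrite big1 => [|i _]; rewrite ?mulr0 ?subr0 // !mxE mul0r.
- have yX := lattX r0 Ly; case: Lx Ly => [xX xY xZ] [yX' yY yZ].
  split=> [i|i|].
  + rewrite hmulX mulrDl.
    exact: rpredD.
  + rewrite hmulY.
    exact: rpredD.
  + have yx : \sum_i y (iX i) 0 * x (iY i) 0 \is a Num.int.
      by apply: rpred_sum => i _; apply: rpredM.
    have := rpredB (rpredD xZ yZ) yx.
    congr (_ \is a Num.int).
    rewrite [in RHS]hmulZ [in RHS](eq_bigr (fun i => hmul x y (iX i) 0 * hmul x y (iY i) 0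
      - x (iX i) 0 * x (iY i) 0 - y (iX i) 0 * y (iY i) 0
      - (y (iX i) 0 * x (iY i) 0) *+ 2)); last first.
      by move=> i _; rewrite hmulX hmulY; ring.
    by rewrite !big_split /= !sumrN sumrMnl; field.
- have xI := lattX r0 Lx; case: Lx => xX xY xZ; split=> [i|i|].
  + by rewrite mxE mulNr rpredN.
  + by rewrite mxE rpredN.
  + have xy : \sum_i x (iX i) 0 * x (iY i) 0 \is a Num.int.
      by apply: rpred_sum => i _; apply: rpredM.
    have := rpredD xZ xy; rewrite -rpredN.
    congr (_ \is a Num.int); rewrite [in RHS]mxE.
    rewrite [in RHS](eq_bigr (fun i => x (iX i) 0 * x (iY i) 0)); last first.
      by move=> i _; rewrite !mxE mulrNN.
    by field.
Qed.

Let Pv r u := exists t : R, Gamma r (u + t *: basisZ R n).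

Let bracketZl (t : R) x : bracket (t *: basisZ R n) x = 0.
Proof.
rewrite /bracket big1 ?scale0r // => i _.
by rewrite !mxE !eE !mulr0 !mul0r subrr.
Qed.

Let PvD r u v : Pv r u -> Pv r v -> Pv r (u + v).
Proof.
move=> [s Gs] [t Gt]; have [_ GM _] := Gamma_subgroup r.
have := GM _ _ Gs Gt; rewrite /hmul [bracket _ _]/bracket; set b := \sum_(i < n) _.
move=> G; exists (s + t + 2^-1 * b); congr (Gamma r _): G.
rewrite scalerA !scalerDl -!addrA; congr (_ + _).
by rewrite addrCA.
Qed.

Let PvN r u : Pv r u -> Pv r (- u).
Proof.
move=> [t Gt]; have [_ _ GV] := Gamma_subgroup r.
by exists (- t); have := GV _ Gt; rewrite /hinv opprD scaleNr.
Qed.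

Let Pv0 r : Pv r 0.
Proof.
by exists 0; rewrite scale0r addr0; have [] := Gamma_subgroup r.
Qed.

Let PvZ r u (z : int) : Pv r u -> Pv r (z%:~R *: u).
Proof.
move=> Pu; have Pn k : Pv r (k%:R *: u).
  elim: k => [|k IH]; first by rewrite scale0r.
  by rewrite -natr1 scalerDl scale1r; exact: PvD.
case: z => k; first exact: Pn.
by rewrite NegzE mulrNz scaleNr; apply: PvN; exact: Pn.
Qed.

Let PvS r (F : 'I_n -> heis) : (forall i, Pv r (F i)) -> Pv r (\sum_i F i).
Proof.
by move=> PF; elim/big_ind: _ => [|u v|i _]; [exact: Pv0|exact: PvD|exact: PF].
Qed.

Let GammaZ r (k : int) x : Gamma r x -> Gamma r (x + k%:~R *: basisZ R n).
Proof.
have [G0 GM GV] := Gamma_subgroup r.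
have GZ : Gamma r (basisZ R n) by apply: sub_gen_smallest; right.
have mulZ z t : hmul (t *: basisZ R n) z = z + t *: basisZ R n.
  by rewrite /hmul bracketZl scaler0 addr0 addrC.
have GZn m z : Gamma r z -> Gamma r (z + m%:R *: basisZ R n).
  move=> Gz; elim: m => [|m IH]; first by rewrite scale0r addr0.
  have := GM _ _ GZ IH; rewrite -[X in hmul X]scale1r mulZ.
  by rewrite -natr1 scalerDl addrA.
case: k => m Gx; first exact: GZn.
have := GM _ _ (GV _ (GZn m.+1 _ G0)) Gx.
by rewrite /hinv add0r -scaleNr mulZ NegzE mulrNz.
Qed.

Let heisP x y : (forall i, x (iX i) 0 = y (iX i) 0) ->
  (forall i, x (iY i) 0 = y (iY i) 0) -> x (iZ n) 0 = y (iZ n) 0 -> x = y.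
Proof.
move=> hX hY hZ; apply/matrixP => i j; rewrite ord1.
case: (split_ordP i) => k ->; last by rewrite ord1.
by case: (split_ordP k) => l ->; [exact: hX|exact: hY].
Qed.

Let int_lt1 (z : R) : z \is a Num.int -> -1 < z < 1 -> z = 0.
Proof.
move=> /intrP[m ->]; rewrite -[1]/(1%:~R) -mulrNz !ltr_int => /andP[m1 m2].
have -> : m = 0 by lia.
by [].
Qed.

Lemma fund_domainP r : (forall i, (0 < r i)%N) ->
  forall g, exists! x, (fund_domain r `&` horbit r g) x.
Proof.
move=> r0 g.
have rgt0 i : 0 < (r i)%:R :> R by rewrite ltr0n.
have fl (t : R) : 0 <= t - (Num.floor t)%:~R < 1.
  by have := floor_itv t; rewrite intrD; lra.
pose u : heis :=
  \sum_i ((- Num.floor (g (iX i) 0 / (r i)%:R))%:~R *: ((r i)%:R *: basisX R i)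
   + (- Num.floor (g (iY i) 0))%:~R *: basisY R i).
have [t Gt] : Pv r u.
  apply: PvS => i; apply: PvD; apply: PvZ; exists 0; rewrite scale0r addr0;
    apply: sub_gen_smallest; left; [left|right]; by exists i.
pose k := - Num.floor (hmul (u + t *: basisZ R n) g (iZ n) 0).
have Gk := GammaZ k Gt; set ga := _ + _ in Gk.
have uX i : u (iX i) 0 = - (Num.floor (g (iX i) 0 / (r i)%:R))%:~R * (r i)%:R.
  rewrite summxE (bigD1 i) //= big1 ?addr0 => [|j ji]; rewrite !mxE !eE.
    by rewrite !mulr0 addr0 mulr1 mulrNz.
  by rewrite eq_sym (negbTE ji) !mulr0 addr0.
have uY i : u (iY i) 0 = - (Num.floor (g (iY i) 0))%:~R.
  rewrite summxE (bigD1 i) //= big1 ?addr0 => [|j ji]; rewrite !mxE !eE.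
    by rewrite !mulr0 add0r mulr1 mulrNz.
  by rewrite eq_sym (negbTE ji) !mulr0 addr0.
have gaX i : ga (iX i) 0 = u (iX i) 0.
  by rewrite !mxE !eE !mulr0 !addr0.
have gaY i : ga (iY i) 0 = u (iY i) 0.
  by rewrite !mxE !eE !mulr0 !addr0.
have [xX [xY xZ]] : fund_domain r (hmul ga g).
  split=> [i|]; last split=> [i|].
  - rewrite hmulX gaX uX addrC mulNr; have := fl (g (iX i) 0 / (r i)%:R).
    move=> /andP[f1 f2].
    have -> : g (iX i) 0 = g (iX i) 0 / (r i)%:R * (r i)%:R.
      by rewrite divfK ?gt_eqF.
    rewrite [in X in _ - X]divfK ?gt_eqF // -mulrBl.
    by rewrite pmulr_lge0 // f1 gtr_pMl.
  - by rewrite hmulY gaY uY addrC fl.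
  - have -> : hmul ga g (iZ n) 0 = hmul (u + t *: basisZ R n) g (iZ n) 0 + k%:~R.
      have -> : hmul ga g = hmul (u + t *: basisZ R n) g + k%:~R *: basisZ R n.
        rewrite /hmul.
        have -> : bracket ga g = bracket (u + t *: basisZ R n) g.
          rewrite /bracket; congr (_ *: _); apply: eq_bigr => i _.
          by rewrite gaX gaY !mxE !eE !mulr0 !addr0.
        set B := 2^-1 *: _; rewrite /ga -!addrA.
        by rewrite [_ *: _ + (g + B)]addrC -!addrA.
      by move: (hmul _ g) => M; rewrite !mxE !eqxx mulr1.
    by rewrite /k mulrNz fl.
exists (hmul ga g); split; first by split => //; exists ga.
move=> y [[yX [yY yZ]] [ga' Gk' yE]]; rewrite -{}yE in yX yY yZ *.
have [LX LY LZ] := Gamma_latt r0 Gk; have [LX' LY' LZ'] := Gamma_latt r0 Gk'.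
have eX i : ga (iX i) 0 = ga' (iX i) 0.
  have /int_lt1 := rpredB (LX i) (LX' i); rewrite -mulrBl => h.
  have {}h : (ga (iX i) 0 - ga' (iX i) 0) / (r i)%:R = 0.
    apply: h; rewrite ltr_pdivlMr // ltr_pdivrMr // mulN1r mul1r.
    by have := xX i; have := yX i; rewrite !hmulX; lra.
  apply/eqP; rewrite -subr_eq0; move/eqP: h.
  by rewrite mulf_eq0 invr_eq0 [_%:R == 0]gt_eqF ?orbF.
have eY i : ga (iY i) 0 = ga' (iY i) 0.
  apply/eqP; rewrite -subr_eq0; apply/eqP/int_lt1; first exact: rpredB.
  by have := xY i; have := yY i; rewrite !hmulY; lra.
suff eZ : ga (iZ n) 0 = ga' (iZ n) 0 by rewrite (heisP eX eY eZ).
apply/eqP; rewrite -subr_eq0; apply/eqP/int_lt1.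
  have := rpredB LZ LZ'; congr (_ \is a Num.int).
  rewrite [in LHS](eq_bigr (fun i => ga' (iX i) 0 * ga' (iY i) 0)).
    by ring.
  by move=> i _; rewrite eX eY.
have := xZ; have := yZ; rewrite !hmulZ.
rewrite [in X in _ -> X -> _](eq_bigr (fun i =>
  ga' (iX i) 0 * g (iY i) 0 - ga' (iY i) 0 * g (iX i) 0)).
  by lra.
by move=> i _; rewrite eX eY.
Qed.

End Lemmas.

(* Main.v *)
Require Import Defs.
From HB Require Import structures.
From mathcomp Require Import all_boot all_order all_algebra.
From mathcomp Require Import perm.
From mathcomp Require Import complex ring lra.
From mathcomp Require Import zify.
From mathcomp Require Import all_classical all_reals all_analysis.
From mathcomp Require Import measurable_realfun.

(** Everything is expressed through two data: the lattice of horizontal parts, in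
    coordinates orthonormal for the metric given by A, with covolume
    (r_1 ... r_n) / |det A|; and the matrix S = A^T J A of the form
    omega([U, V]) in an orthonormal basis (omega_mx A), with determinant
    (det A)^2 up to sign.

    - The eigenvalues of S are the pairs of opposite imaginary numbers i d_k, and
      the squared Frobenius norm of S is twice the sum of the d_k^2
      (dtuple_exists, dtuple_sum_sqr). So an upper bound on d_n is the same as an
      upper bound on the Frobenius norm |S|.
    - The total Popp measure is (r_1 ... r_n) / (|S| |det A|)
      (is_popp_meas_val).
    - The diameter of the quotient is comparable to the covering radius of the
      lattice. On one side a horizontal path is at least as long as its projection
      (covered_of_diam); this rests on the bound of the increment of an absolutely
      continuous function by the integral of its derivative (AC01_increment_le).
      On the other side, once the horizontal parts agree, the missing height is at
      most 1 modulo the lattice and is gained by a loop enclosing a suitable area;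
      this is cheap as soon as some entry of S is not small (diam_le).

    Given the bounds on the shortest vector, the determinant and d_n, the entries
    of S are bounded, hence so is |det A|, and the measure is bounded from below.
    The covering radius is bounded because the lattice has no short vector and
    bounded covolume (covered_of_sep, by Hermite reduction), and S has an entry
    that is not small because its determinant is not.

    Conversely, a bound on the covering radius gives lattice vectors close to a
    large multiple of the canonical basis; their determinant is a nonzero integer
    multiple of the covolume. This bounds the covolume from above, and therefore
    |det A| from below (covered_det_le). The measure then bounds |S|, hence d_n and
    |det A|, from above. Finally, exchanging one of these vectors with a lattice
    vector x still gives a nonzero multiple of the covolume, now bounded from
    below, so that x cannot be short (covered_short_vector). *)

Set Implicit Arguments.
Unset Strict Implicit.
Unset Printing Implicit Defensive.

Import Order.TTheory GRing.Theory Num.Theory.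
Import numFieldNormedType.Exports.

Local Open Scope classical_set_scope.
Local Open Scope ring_scope.

(** * Increments of absolutely continuous functions *)

(** Two-sided comparison around each point suffices because the supremum of the
    points reached below the initial level is itself reached and cannot be
    interior: only pairs a <= t <= b straddling t are compared. *)
Lemma locally_nonincreasing_le (R : realType) (psi : R -> R) :
  (forall t, 0 <= t <= 1 -> exists2 e, 0 < e & forall a b,
     0 <= a -> b <= 1 -> t - e < a -> a <= t -> t <= b -> b < t + e ->
     psi b <= psi a) ->
  psi 1 <= psi 0.
Proof.
move=> loc; pose S := [set t | 0 <= t <= 1 /\ psi t <= psi 0].
have S0 : S 0 by split=> //; lra.
have supS : has_sup S.
  by split; [exists 0|exists 1 => t [/andP[]]].
have s0 : 0 <= sup S by exact: ub_le_sup supS.2 _ S0.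
have s1 : sup S <= 1 by apply: ge_sup supS.1 _ => t [/andP[]].
have [e e0 He] := loc (sup S) (introT andP (conj s0 s1)).
have [a [/andP[a0 a1] ga] ea] := sup_adherent e0 supS.
have aS : a <= sup S by apply: ub_le_sup supS.2 _ _; split=> //; apply/andP.
have psis : psi (sup S) <= psi 0.
  by apply: le_trans ga; apply: He => //; lra.
have [<-//|sn1] := eqVneq (sup S) 1.
have {}s1 : sup S < 1 by rewrite lt_neqAle sn1.
pose b := Num.min 1 (sup S + e / 2).
have b1 : b <= 1 by rewrite ge_min lexx.
have sb : sup S < b by rewrite lt_min s1 ltrDl divr_gt0.
have be : b < sup S + e by rewrite gt_min ltrD2l; apply/orP; right; lra.
have : S b.
  split; first lra.
  by apply: le_trans psis; apply: He => //; lra.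
by move/(ub_le_sup supS.2); lra.
Qed.

(** The integral of a nonnegative function is a supremum over the simple functions
    below it, so it is monotone without measurability; this matters for the speed
    of a path, whose value is arbitrary where the path is not differentiable. *)
Lemma ge0_le_integral_nonmeas d (T : measurableType d) (R : realType)
    (mu : {measure set T -> \bar R}) (f g : T -> \bar R) :
  (forall x, 0 <= f x)%E -> (forall x, f x <= g x)%E ->
  (\int[mu]_x f x <= \int[mu]_x g x)%E.
Proof.
move=> f0 fg; rewrite !ge0_integralTE //; last first.
  by move=> x; exact: le_trans (f0 x) (fg x).
apply: le_ereal_sup => _ [h /= hf <-]; exists h => //= x.
exact: le_trans (hf x) (fg x).
Qed.

Definition AC01 (R : realType) (f : R -> R) : Prop :=
  forall eps : R, 0 < eps -> exists2 delta : R, 0 < delta &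
    forall (m : nat) (a b : 'I_m -> R),
      (forall i, 0 <= a i /\ a i <= b i /\ b i <= 1) ->
      trivIset [set: 'I_m] (fun i => `]a i, b i[%classic) ->
      \sum_i (b i - a i) < delta ->
      \sum_i `|f (b i) - f (a i)| < eps.

(** Additivity of Lebesgue measure, to bound the total length that absolute
    continuity refers to by the measure of a small open set. *)
Lemma sum_disjoint_itv_le (R : realType) (O : set R) m (a b : 'I_m -> R) :
  measurable O -> (forall i, a i <= b i) ->
  (forall i, `]a i, b i[%classic `<=` O) ->
  trivIset [set: 'I_m] (fun i => `]a i, b i[%classic) ->
  ((\sum_i (b i - a i))%:E <= lebesgue_measure O)%E.
Proof.
move=> mO ab sub triv; rewrite -sumEFin.
have -> : (\sum_i (b i - a i)%:E = 
   \sum_i @lebesgue_measure R `]a i, b i[%classic)%E.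
  apply: eq_bigr => i _; rewrite lebesgue_measure_itv /= lte_fin.
  have := ab i; rewrite le_eqVlt => /predU1P[->|->]; last by rewrite EFinB.
  by rewrite ltxx subrr.
have mbig : measurable (\big[setU/set0]_(i < m) `]a i, b i[%classic).
  by apply: bigsetU_measurable.
rewrite -measure_semi_additive_ord //.
apply: le_measure; rewrite ?inE //.
by elim/big_ind: _ => // A B AO BO x [/AO|/BO].
Qed.

Section OpenVariation.
Variables (R : realType) (f : R -> R) (O : set R).

Definition itv_family_sum (t s : R) : Prop :=
  exists (m : nat) (a b : 'I_m -> R), [/\
    forall i, 0 <= a i /\ a i <= b i /\ b i <= 1,
    forall i, b i <= t, trivIset [set: 'I_m] (fun i => `]a i, b i[%classic),
    forall i, `]a i, b i[%classic `<=` O & s = \sum_i `|f (b i) - f (a i)|].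

Lemma itv_family_sum0 t : itv_family_sum t 0.
Proof.
exists 0%N, (fun _ => 0), (fun _ => 0).
by split=> [[]|[]|[]|[]|] //; rewrite big_ord0.
Qed.

Lemma itv_family_sum_le s t x : s <= t -> itv_family_sum s x -> itv_family_sum t x.
Proof.
move=> st [m [a [b [h1 h2 h3 h4 h5]]]]; exists m, a, b; split=> // i.
exact: le_trans st.
Qed.

Lemma itv_family_sum_cons a0 b0 x : 0 <= a0 -> a0 <= b0 -> b0 <= 1 ->
  `]a0, b0[%classic `<=` O -> itv_family_sum a0 x ->
  itv_family_sum b0 (`|f b0 - f a0| + x).
Proof.
move=> a00 ab0 b01 sub [m [a [b [h1 h2 h3 h4 h5]]]].
pose A i := oapp a a0 (unlift (@ord0 m) i).
pose B i := oapp b b0 (unlift (@ord0 m) i).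
have disj j y : `]a j, b j[%classic y -> `]a0, b0[%classic y -> False.
  rewrite /= !in_itv /= => /andP[_ u] /andP[v _]; have := h2 j; lra.
exists m.+1, A, B; split.
- by move=> i; rewrite /A /B; case: unliftP => [j _|_] //=.
- move=> i; rewrite /B; case: unliftP => [j _|_] //=.
  exact: le_trans (h2 j) _.
- move=> i j _ _; rewrite /A /B.
  case: unliftP => [i' ->|->]; case: unliftP => [j' ->|->] //= -[y [y1 y2]].
  + by rewrite (h3 i' j') //; exists y.
  + by case: (disj i' y).
  + by case: (disj j' y).
- by move=> i; rewrite /A /B; case: unliftP => [j _|_] //=; exact: h4.
- rewrite big_ord_recl /A /B unlift_none /= h5; congr (_ + _).
  by apply: eq_bigr => i _; rewrite liftK.
Qed.

(** Variation on [0, t] carried by the open set O; absolute continuity makes it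
    small when O has small measure, and it dominates the increments of f over the
    intervals contained in O. *)
Definition open_variation (t : R) : R := sup [set s | itv_family_sum t s].

Variable e : R.
Hypothesis bnd : forall t s, itv_family_sum t s -> s <= e.

Let hs t : has_sup [set s | itv_family_sum t s].
Proof.
split; first by exists 0; exact: itv_family_sum0.
by exists e => s; exact: bnd.
Qed.

Lemma open_variation_ge0 t : 0 <= open_variation t.
Proof. by apply: ub_le_sup (hs t).2 _ _; exact: itv_family_sum0. Qed.

Lemma open_variation_bound t : open_variation t <= e.
Proof. by apply: ge_sup (hs t).1 _ => s; exact: bnd. Qed.

Lemma open_variation_homo s t : s <= t -> open_variation s <= open_variation t.
Proof.
move=> st; apply: ge_sup (hs s).1 _ => x hx; apply: ub_le_sup (hs t).2 _ _.
exact: itv_family_sum_le hx.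
Qed.

Lemma open_variation_incr a b : 0 <= a -> a <= b -> b <= 1 ->
  `]a, b[%classic `<=` O ->
  `|f b - f a| <= open_variation b - open_variation a.
Proof.
move=> a0 ab b1 sub; rewrite lerBrDl -lerBrDr.
apply: ge_sup (hs a).1 _ => x hx; rewrite lerBrDl.
by apply: ub_le_sup (hs b).2 _ _; exact: itv_family_sum_cons.
Qed.

End OpenVariation.

Lemma derivable_local_approx (R : realType) (F : R -> R) (t e : R) :
  derivable F t 1 -> 0 < e -> exists2 del, 0 < del & forall x, `|x - t| < del ->
   `|F x - F t - derive1 F t * (x - t)| <= e * `|x - t|.
Proof.
move=> dF e0; have : (h^-1 *: (F (h *: 1 + t) - F t)) @[h --> 0^'] --> derive1 F t.
  by rewrite derive1E; exact: dF.
move/cvgrPdist_le => /(_ e e0) /nbhs_ballP [del /= del0 Hd].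
exists del => // x xt; have [->|xnt] := eqVneq x t.
  by rewrite !subrr mulr0 subrr normr0 mulr0.
have xt0 : x - t != 0 by rewrite subr_eq0.
have := Hd (x - t); rewrite /ball /=  sub0r normrN => /(_ xt xt0).
rewrite /= scaler1 subrK => H.
rewrite -ler_pdivrMr ?normr_gt0 // -normrV ?unitfE // -normrM -normrN.
apply: le_trans H; rewrite le_eqVlt; apply/orP; left; apply/eqP.
by congr (`|_|); rewrite /GRing.scale /=; field.
Qed.

Lemma derivable_local_le (R : realType) (F : R -> R) (t e : R) :
  derivable F t 1 -> derive1 F t <= 0 -> 0 < e ->
  exists2 del, 0 < del & forall a b,
    t - del < a -> a <= t -> t <= b -> b < t + del -> F b - F a <= e * (b - a).
Proof.
move=> dF F0 e0; have [del del0 H] := derivable_local_approx dF e0.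
exists del => // a b ta a_t tb bt.
have := H a; rewrite [`|a - t|]ler0_norm ?subr_le0 // => /(_ _)/wrap[|]; first lra.
have := H b; rewrite [`|b - t|]ger0_norm ?subr_ge0 // => /(_ _)/wrap[|]; first lra.
move=> /ler_normlP[_ Hb] /ler_normlP[Ha _].
have : derive1 F t * (b - a) <= 0 by rewrite mulr_le0_ge0 // subr_ge0; lra.
lra.
Qed.

(** On D the derivative is the limit of difference quotients of the continuous
    function that extends the restriction of f to [0, 1] by constants, whatever f is
    outside. *)
Lemma AC01_derive_measurable (R : realType) (f : R -> R) (D : set R) :
  AC01 f -> measurable D -> D `<=` `]0, 1[%classic ->
  (forall t, D t -> derivable f t 1) -> measurable_fun D (derive1 f).
Proof.
move=> acf mD D01 df.
pose cl (t : R) := Num.max 0 (Num.min t 1).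
have cl01 t : 0 <= cl t <= 1.
  rewrite /cl le_max lexx /= ge_max ler01 /= ge_min lexx orbT //.
have clE t : 0 <= t <= 1 -> cl t = t.
  by move=> /andP[t0 t1]; rewrite /cl (min_idPl t1) (max_idPr t0).
have clL s t : s <= t -> cl s <= cl t <= cl s + (t - s).
  by rewrite /cl => st; case: (leP s 1) => ?; case: (leP t 1) => ?;
    rewrite ?(max_r ler01);
    case: (leP 0 s) => ?; case: (leP 0 t) => ?; lra.
have cF : continuous (f \o cl).
  move=> t; apply/cvgrPdist_lt => e e0; have [del del0 H] := acf e e0.
  apply/nbhs_ballP; exists del => //= s; rewrite /ball /= => st.
  have key u v : u <= v -> v - u < del -> `|f (cl v) - f (cl u)| < e.
    move=> uv vu; have := H 1%N (fun _ => cl u) (fun _ => cl v).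
    rewrite !big_ord1; apply.
    - by move=> _; have := cl01 u; have := cl01 v; have := clL u v uv; lra.
    - by move=> i j _ _ _; rewrite !ord1.
    - by have := clL u v uv; lra.
  have [ts|/ltW ts] := leP s t.
    by apply: key => //; move: st => /ltr_normlP[]; lra.
  by rewrite distrC; apply: key => //; move: st => /ltr_normlP[]; lra.
pose q n t : R := n.+1%:R * ((f \o cl) (t + n.+1%:R^-1) - (f \o cl) t).
apply: (@measurable_fun_cvg _ _ _ _ q).
  move=> n; apply: measurable_funS (@measurableT _ _) (@subsetT _ _) _.
  apply: continuous_measurable_fun => t; apply: cvgM; first exact: cvg_cst.
  apply: cvgB; last exact: cF.
  apply: (@cvg_comp _ _ _ (fun s => s + n.+1%:R^-1) (f \o cl) (nbhs t)
    (nbhs (t + n.+1%:R^-1))); last exact: cF.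
  by apply: cvgD; [exact: cvg_id|exact: cvg_cst].
move=> t Dt; apply/cvgrPdist_le => e e0.
have [del del0 H] := derivable_local_approx (df t Dt) e0.
have /= := D01 t Dt; rewrite in_itv /= => /andP[t0 t1].
have small : \forall n \near \oo, n.+1%:R^-1 < Num.min del (1 - t).
  have m0 : 0 < Num.min del (1 - t) by rewrite lt_min del0 subr_gt0.
  exact: near_infty_natSinv_lt (PosNum m0).
apply: filterS small => n; rewrite lt_min => /andP[nd nt].
have n0 : 0 < n.+1%:R^-1 :> R by rewrite invr_gt0.
rewrite /q /= clE; last by move: (n.+1%:R^-1) n0 nd nt => u; lra.
rewrite clE; last by lra.
have := H (t + n.+1%:R^-1); rewrite addrAC subrr add0r gtr0_norm // => /(_ nd).
rewrite -ler_pdivrMr // -[X in _ / X]gtr0_norm // -normf_div -normrN.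
apply: le_trans; rewrite le_eqVlt; apply/orP; left; apply/eqP.
by congr (`|_|); field; rewrite nat1r pnatr_eq0.
Qed.

(** One half of the fundamental theorem of calculus for absolutely continuous
    functions. Let h be the positive part of the derivative off a null set, H its
    primitive, B an open set of small measure containing all bad points, and V the
    variation of f carried by B. Then f - H - V - e t is locally nonincreasing: at a
    bad point V absorbs the increment of f, elsewhere H has derivative h >= f' by the
    Lebesgue differentiation theorem. *)
Lemma AC01_increment_le (R : realType) (f g : R -> R) (M : R) :
  AC01 f -> (forall t, 0 <= g t) ->
  {ae @lebesgue_measure R, forall t, t \in `[0, 1] ->
     derivable f t 1 /\ derive1 f t <= g t} ->
  (\int[@lebesgue_measure R]_(t in `[0%R, 1%R]) (g t)%:E <= M%:E)%E ->
  f 1 - f 0 <= M.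
Proof.
move=> acf g0 [N1 [mN1 N10 sub1]] intg.
set mu := @lebesgue_measure R in N10 intg.
pose D := `]0, 1[%classic `\` N1.
have D01 : D `<=` `]0, 1[%classic by move=> t [].
have mD : measurable D by apply: measurableD.
have dD t : D t -> derivable f t 1 /\ derive1 f t <= g t.
  move=> [t01 nN]; apply: contrapT => bad; apply/nN/sub1 => /= /(_ _)/wrap[|//].
  by move: t01; rewrite /= !in_itv /= => /andP[/ltW-> /ltW->].
pose h := (fun t => Num.max 0 (derive1 f t)) \_ D.
have h0 t : 0 <= h t by rewrite /h /patch; case: ifP => // _; rewrite le_max lexx.
have mh : measurable_fun setT h.
  apply/(measurable_restrictT _ mD); apply: measurable_maxr => //.
  by apply: AC01_derive_measurable => // t /dD[].
have Ih : (\int[mu]_t (h t)%:E <= M%:E)%E.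
  apply: le_trans intg; rewrite [leRHS]integral_mkcond.
  apply: ge0_le_integral_nonmeas => t; first by rewrite lee_fin.
  rewrite /h /patch; case: ifPn => [|_].
    rewrite inE => Dt; rewrite ifT; last first.
      by rewrite inE; have := D01 _ Dt; rewrite /= !in_itv /= => /andP[/ltW-> /ltW->].
    by rewrite lee_fin ge_max g0; have [] := dD _ Dt.
  by case: ifP; rewrite lee_fin.
have hint A : measurable A -> mu.-integrable A (EFin \o h).
  move=> mA; apply: (@integrableS _ _ _ mu setT) => //.
  apply/integrableP; split; first exact/measurable_EFinP.
  apply: le_lt_trans (ltry M); apply: le_trans Ih.
  rewrite le_eqVlt; apply/predU1P; left; apply: eq_integral => t _.
  by rewrite /= ger0_norm.
pose H x := \int[mu]_(t in `]-oo, x]) h t.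
have Hh : {ae mu, forall x, derivable H x 1 /\ derive1 H x = h x}.
  apply: FTC1Ny; first by move=> y; exact: hint.
  apply: open_integrable_locally; first exact: openT.
  exact: hint.
have [N2 [mN2 N20 sub2]] := Hh.
have HE x : (H x)%:E = (\int[mu]_(t in `]-oo, x]) (h t)%:E)%E.
  by rewrite /H /Rintegral fineK //; apply: integrable_fin_num => //; exact: hint.
have Hge0 x : 0 <= H x by apply: Rintegral_ge0.
have HM x : H x <= M.
  rewrite -lee_fin HE; apply: le_trans Ih.
  apply: ge0_subset_integral => //; first exact/measurable_EFinP.
  by move=> t _; rewrite lee_fin.
have Hhomo x y : x <= y -> H x <= H y.
  move=> xy; rewrite -lee_fin !HE; apply: ge0_subset_integral => //.
  - apply/measurable_EFinP; exact: measurable_funS mh.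
  - by move=> t _; rewrite lee_fin.
  - by move=> t; rewrite /= !in_itv /=; move/le_trans; apply.
(* The endpoints are counted as bad points: nothing is known of f outside [0, 1]. *)
pose N := N1 `|` N2 `|` [set 0; 1].
have mN : measurable N by do 2?apply: measurableU.
have N0 : mu N = 0%E.
  apply/negligibleP => //; do 2?apply: negligibleU; apply/negligibleP => //.
  exact: lebesgue_measure_set1.
  exact: lebesgue_measure_set1.
apply/ler_addgt0Pr => e e0.
have e2 : 0 < e / 2 by rewrite divr_gt0.
have [del del0 acd] := acf _ e2.
have [B [oO NB mO]] : exists B, [/\ open B, N `<=` B & (mu (B `\` N) < del%:E)%E].
  have Nfin : (mu N < +oo)%E by rewrite N0.
  exact: lebesgue_regularity_outer mN Nfin del0.
have mO' : measurable B by exact: open_measurable.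
have {}mO : (mu B < del%:E)%E.
  have -> : (mu B = mu N + mu (B `\` N))%E.
    rewrite -[in LHS](setDUK NB).
    exact: (@measureU _ _ _ mu N (B `\` N) mN (measurableD mO' mN) (setDIK _ _)).
  by rewrite N0 add0e.
pose V := open_variation f B.
have bnd t s : itv_family_sum f B t s -> s <= e / 2.
  move=> [m [a [b [h1 h2 h3 h4 ->]]]]; apply/ltW/acd => //.
  rewrite -lte_fin; apply: le_lt_trans mO; apply: sum_disjoint_itv_le => //.
  by move=> i; have := h1 i; lra.
have Vhomo := open_variation_homo bnd.
(* Of the two errors e / 2, one is the total of V and the other the linear term. *)
have := @locally_nonincreasing_le _ (fun t => f t - H t - V t - e / 2 * t).
move=> /(_ _)/wrap[|]; last first.
  have := open_variation_ge0 bnd 0; have := open_variation_bound bnd 1.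
  by rewrite -/V; have := HM 1; have := Hge0 0; lra.
move=> t t01; have [Nt|nNt] := pselect (N t).
  have : nbhs t B by apply: open_nbhs_nbhs; split=> //; exact: NB.
  move=> /nbhs_ballP[d /= d0 Hd]; exists d => // a b a0 b1 ta at_ tb bt.
  have sub : `]a, b[%classic `<=` B.
    move=> x; rewrite /= in_itv /= => xab; apply: Hd; rewrite /ball /=.
    by rewrite ltr_norml; lra.
  have := open_variation_incr bnd a0 (le_trans at_ tb) b1 sub.
  rewrite -/V => /ler_normlP[_ HV]; have := Hhomo a b (le_trans at_ tb).
  have : e / 2 * a <= e / 2 * b by rewrite ler_pM2l //; lra.
  lra.
have Dt : D t.
  split; last by move=> ?; apply: nNt; left; left.
  rewrite /= in_itv /= !lt_neqAle; case/andP: t01 => -> ->; rewrite !andbT.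
  apply/andP; split; apply/eqP => E; apply: nNt; right; [left|right] => //.
have [dft _] := dD _ Dt.
have [dHt H't] : derivable H t 1 /\ derive1 H t = h t.
  by apply: contrapT => bad; apply: nNt; left; right; apply: sub2.
have dfH : derivable (f \- H) t 1 by apply: derivableB.
have dle : derive1 (f \- H) t <= 0.
  have -> : derive1 (f \- H) t = derive1 f t - derive1 H t.
    by rewrite !derive1E (deriveB dft dHt).
  rewrite H't subr_le0 /h /patch.
  by rewrite mem_set // le_max lexx orbT.
have [d d0 Hd] := derivable_local_le dfH dle e2.
exists d => // a b a0 b1 ta at_ tb bt; have := Hd a b ta at_ tb bt => /=.
by have := Vhomo a b (le_trans at_ tb); rewrite -/V; lra.
Qed.

(** * Covering radius of a lattice *)

Section Covering.
Variable R : realType.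

Local Notation "z %:MR" := (map_mx (intr : int -> R) z) (at level 2, format "z %:MR").

Definition qform m (G : 'M[R]_m) (x : 'cV[R]_m) : R := (x^T *m G *m x) 0 0.

Definition posdef m (G : 'M[R]_m) : Prop :=
  G^T = G /\ forall x, x != 0 -> 0 < qform G x.

Lemma qform_congr m p (G : 'M[R]_m) (L : 'M[R]_(m, p)) y :
  qform (L^T *m G *m L) y = qform G (L *m y).
Proof. by rewrite /qform trmx_mul !mulmxA. Qed.

Lemma qformZ m (G : 'M[R]_m) a x : qform G (a *: x) = a ^+ 2 * qform G x.
Proof. by rewrite /qform [(_ *: _)^T]linearZ /= -!scalemxAl -scalemxAr scalerA mxE expr2. Qed.

Lemma exists_round (t : R) : exists k : int, (t - k%:~R) ^+ 2 <= 4^-1.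
Proof.
exists (Num.floor (t + 2^-1)); have := floor_itv (t + 2^-1).
rewrite intrD => /andP[f1 f2]; set f := (Num.floor _)%:~R in f1 f2 *.
have : `|t - f| <= 2^-1 by rewrite ler_norml; lra.
rewrite -[(_ - _) ^+ 2]real_normK ?num_real // => h.
have -> : 4^-1 = 2^-1 ^+ 2 :> R by field.
by rewrite ler_sqr ?nnegrE ?normr_ge0.
Qed.

Section Schur.
Variables (m : nat) (G : 'M[R]_(1 + m)).
Hypothesis pG : posdef G.

Let g := G 0 0.
Let h : 'rV[R]_m := ursubmx G.

Definition schur : 'M[R]_m := drsubmx G - g^-1 *: (h^T *m h).

Let blockG : G = block_mx g%:M h h^T (drsubmx G).
Proof.
have [symG _] := pG.
rewrite -{1}(submxK G) -/h; congr (block_mx _ _ _ _).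
  rewrite [LHS]mx11_scalar; congr (_%:M); rewrite !mxE.
  by congr (G _ _); apply: val_inj.
by rewrite /h -[in RHS]symG -trmx_dlsub trmxK.
Qed.

Lemma schur_corner_gt0 : 0 < G 0 0.
Proof.
have [_ /(_ (delta_mx 0 0))] := pG; rewrite /qform trmx_delta -rowE -colE !mxE.
by apply; apply/negP => /eqP /matrixP /(_ 0 0); rewrite !mxE eqxx => /eqP; rewrite oner_eq0.
Qed.

Let g0 : g != 0. Proof. by rewrite gt_eqF // schur_corner_gt0. Qed.

(** Completing the square in the first variable: the Schur complement is the
    quadratic form of the lattice projected orthogonally to its first basis vector. *)
Lemma qform_schur t y :
  qform G (col_mx t%:M y) = g * (t + (h *m y) 0 0 / g) ^+ 2 + qform schur y.
Proof.
rewrite /qform {1}blockG tr_col_mx tr_scalar_mx mul_row_block mul_row_col.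
set s := (h *m y) 0 0.
have hy : h *m y = s%:M by rewrite [LHS]mx11_scalar.
have yh : y^T *m h^T = s%:M by rewrite -trmx_mul hy tr_scalar_mx.
have yhhy : y^T *m (h^T *m h) *m y = (s * s)%:M.
  by rewrite -!mulmxA hy mulmxA yh -scalar_mxM.
rewrite /schur mulmxBr mulmxBl -scalemxAr -scalemxAl yhhy yh !mulmxDl.
rewrite -!mulmxA hy mulmxA -!scalar_mxM.
move: (y^T *m (drsubmx G *m y)) => w; rewrite !mxE eqxx !mulr1n.
by field.
Qed.

Lemma det_schur : \det G = g * \det schur.
Proof.
have -> : G = block_mx 1%:M 0 (g^-1 *: h^T) 1%:M *m block_mx g%:M h 0 schur.
  rewrite {1}blockG mulmx_block !mul1mx !mul0mx ?mulmx0 ?addr0 ?add0r.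
  congr (block_mx _ _ _ _); rewrite ?mul_mx_scalar ?scalerA ?mulfV ?scale1r //.
  by rewrite -scalemxAl /schur addrC subrK.
by rewrite det_mulmx det_lblock det_ublock !det1 !mul1r det_scalar expr1.
Qed.

Lemma posdef_schur : posdef schur.
Proof.
have [symG pos] := pG; split.
  by rewrite /schur linearB /= trmx_drsub symG linearZ /= trmx_mul trmxK.
move=> y y0; have := pos (col_mx (- ((h *m y) 0 0 / g))%:M y).
rewrite qform_schur addNr expr0n /= mulr0 add0r; apply.
by apply: contraNneq y0 => /(congr1 (@dsubmx _ 1 m 1)); rewrite col_mxKd linear0 => ->.
Qed.

End Schur.

Definition lattice_covered m (G : 'M[R]_m) (D : R) : Prop :=
  forall x, exists z : 'cV[int]_m, qform G (x - z%:MR) <= D.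

Definition lattice_sep m (G : 'M[R]_m) (c : R) : Prop :=
  forall z : 'cV[int]_m, z != 0 -> c <= qform G z%:MR.

Lemma mapR_neq0 m (z : 'cV[int]_m) : z != 0 -> z%:MR != 0.
Proof.
apply: contraNneq => /matrixP zE; apply/eqP/matrixP => i j.
by have := zE i j; rewrite !mxE => /eqP; rewrite intr_eq0 => /eqP.
Qed.

(** If the first basis vector is almost shortest, then a vector of the projected
    lattice lifts to a lattice vector whose component along the first one is at most
    half of it, hence cannot be too short. The squared covering radius grows by at
    most the square of that half. *)
Lemma covered_step m (G : 'M[R]_(1 + m)) D : posdef G ->
  lattice_sep G (G 0 0 / 2) ->
  lattice_sep (schur G) (G 0 0 / 4) /\
  (lattice_covered (schur G) D -> lattice_covered G (G 0 0 / 4 + D)).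
Proof.
move=> pG sepg; have g0 := schur_corner_gt0 pG; split.
  move=> z z0; have [k hk] := exists_round (- ((ursubmx G *m z%:MR) 0 0 / G 0 0)).
  pose zz : 'cV[int]_(1 + m) := col_mx k%:M z.
  have zz0 : zz != 0.
    apply: contraNneq z0 => /(congr1 (@dsubmx _ 1 m 1)).
    by rewrite col_mxKd linear0 => ->.
  have := sepg _ zz0; rewrite map_col_mx map_scalar_mx /= qform_schur //.
  set u := _ / _ in hk *.
  have : G 0 0 * (k%:~R + u) ^+ 2 <= G 0 0 / 4.
    by rewrite ler_pM2l //; have -> : (k%:~R + u) ^+ 2 = (- u - k%:~R) ^+ 2 by ring.
  lra.
move=> cov x; have [z hz] := cov (dsubmx x).
set y := dsubmx x - z%:MR in hz.
have [k hk] := exists_round (usubmx x 0 0 + (ursubmx G *m y) 0 0 / G 0 0).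
exists (col_mx k%:M z).
have -> : x - (col_mx k%:M z)%:MR = col_mx (usubmx x 0 0 - k%:~R)%:M y.
  rewrite map_col_mx map_scalar_mx -{1}(vsubmxK x) opp_col_mx add_col_mx.
  by congr (col_mx _ _); rewrite {1}[usubmx x]mx11_scalar -raddfB.
rewrite qform_schur //; apply: lerD => //; rewrite ler_pM2l //.
by rewrite addrAC.
Qed.

(** A factor 2 from the infimum is enough for the reduction and spares the
    discreteness of the values of a positive definite form on integer vectors. *)
Lemma almost_shortest m (G : 'M[R]_m.+1) c : 0 < c -> lattice_sep G c ->
  exists2 p : 'cV[int]_m.+1, p != 0 &
    forall z : 'cV[int]_m.+1, z != 0 -> qform G p%:MR <= 2 * qform G z%:MR.
Proof.
move=> c0 sep; pose S := [set qform G z%:MR | z in [set z : 'cV[int]_m.+1 | z != 0]].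
have S0 : has_inf S.
  split; last by exists c => _ [z z0 <-]; exact: sep.
  exists (qform G (const_mx 1)%:MR), (const_mx 1) => //=.
  by apply/eqP => /matrixP /(_ 0 0); rewrite !mxE.
have ci : c <= inf S.
  by apply: lb_le_inf S0.1 _ => _ [z z0 <-]; exact: sep.
have i0 : 0 < inf S by exact: lt_le_trans ci.
have [_ [p p0 <-] hp] := inf_adherent i0 S0.
exists p => // z z0; have : inf S <= qform G z%:MR.
  by apply: ge_inf S0.2 _ _; exists z.
lra.
Qed.

Lemma unit_int_mxR m (L : 'M[int]_m) : L \in unitmx -> \det L%:MR ^+ 2 = 1.
Proof.
rewrite unitmxE det_map_mx /= => uL.
have : (\det L == 1) || (\det L == - 1) := uL.
by rewrite -rmorphXn /= => /orP[] /eqP ->.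
Qed.

(** The Smith normal form of a column completes its primitive part to a basis. *)
Lemma unimodular_first_col m (p : 'cV[int]_m.+1) : p != 0 ->
  exists2 L : 'M[int]_m.+1, L \in unitmx &
    exists2 k : int, k != 0 & p = k *: col 0 L.
Proof.
move=> p0; have [L uL [Q uQ [d _ pE]]] := int_Smith_normal_form p.
have pE' : p = (d`_0 * Q 0 0) *: col 0 L.
  rewrite {1}pE [Q]mx11_scalar mul_mx_scalar.
  have -> : (\matrix_(i, j) (d`_i *+ (i == j :> nat)) : 'M[int]_(m.+1, 1)) =
            d`_0 *: delta_mx 0 0.
    apply/matrixP => i j; rewrite !mxE !ord1 andbT.
    by case: i => -[|i] hi; rewrite ?mulr1 // mulr0.
  by rewrite -scalemxAr -colE scalerA mulrC !mxE eqxx.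
exists L => //; exists (d`_0 * Q 0 0) => //.
by apply: contraNneq p0 => dQ; rewrite pE' dQ scale0r.
Qed.

Lemma posdef_congr m (G : 'M[R]_m) (L : 'M[R]_m) : L \in unitmx ->
  posdef G -> posdef (L^T *m G *m L).
Proof.
move=> uL [symG pos]; split; first by rewrite !trmx_mul trmxK symG mulmxA.
move=> x x0; rewrite qform_congr; apply: pos.
by apply: contraNneq x0 => /(congr1 (mulmx (invmx L))); rewrite mulKmx // mulmx0 => ->.
Qed.

Lemma posdef_det_gt0 m (G : 'M[R]_m) : posdef G -> 0 < \det G.
Proof.
elim: m G => [|m IH] G pG; first by rewrite det_mx00.
by rewrite (det_schur pG) mulr_gt0 ?schur_corner_gt0 //; apply/IH/posdef_schur.
Qed.

Lemma mapR_mul m p q (A : 'M[int]_(m, p)) (B : 'M[int]_(p, q)) :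
  (A *m B)%:MR = A%:MR *m B%:MR.
Proof. exact: map_mxM. Qed.

(** The first basis vector is not too long: half of a basis vector of the projected
    lattice is at least half of the shortest length away from that lattice, and in
    dimension one the Gram determinant is the squared length itself. *)
Lemma corner_bound m (G : 'M[R]_(1 + m)) D V : posdef G ->
  lattice_sep (schur G) (G 0 0 / 4) -> lattice_covered (schur G) D ->
  \det G <= V -> G 0 0 <= `|V| + 16 * `|D|.
Proof.
have V0 := ler_norm V; have D0 := ler_norm D.
have := normr_ge0 V; have := normr_ge0 D.
case: m G => [|m] G nD nV pG sepS covS; rewrite (det_schur pG).
  by rewrite det_mx00 mulr1; lra.
move=> _; have [z hz] := covS (2^-1 *: (delta_mx 0 0)).
have z0 : delta_mx 0 0 - 2 *: z != 0 :> 'cV[int]_m.+1.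
  by apply/eqP => /matrixP /(_ 0 0); rewrite !mxE /=; lia.
have := sepS _ z0.
have -> : (delta_mx 0 0 - 2 *: z)%:MR = 2 *: (2^-1 *: delta_mx 0 0 - z%:MR) :> 'cV[R]_m.+1.
  rewrite map_mxB map_delta_mx map_mxZ scalerBr scalerA mulfV ?scale1r //.
rewrite qformZ; lra.
Qed.

(** A lattice with a lower bound on its nonzero vectors and an upper bound on its
    covolume has bounded covering radius. Hermite reduction: project along an almost
    shortest vector and induct on the dimension, working with Gram matrices so that
    the projection is a Schur complement. *)
Theorem covered_of_sep m (c V : R) : 0 < c -> exists D : R, forall G : 'M[R]_m,
  posdef G -> lattice_sep G c -> \det G <= V -> lattice_covered G D.
Proof.
elim: m c V => [|m IH] c V c0.
  exists 0 => G pG _ _ x; exists 0.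
  by rewrite /qform mxE big_ord0.
have c4 : 0 < c / 4 by rewrite divr_gt0.
(* Projecting divides the Gram determinant by the value of the form at the first
   basis vector, at least c, and divides the lower bound c by at most 4. *)
have [D HD] := IH (c / 4) (`|V| / c) c4.
exists ((`|V| + 16 * `|D|) / 4 + D) => G pG sepG detG.
have [p p0 hp] := almost_shortest c0 sepG.
have [L uL [k k0 pE]] := unimodular_first_col p0.
have uLR : L%:MR \in unitmx.
  rewrite unitmxE unitfE; apply/eqP => d0; have := unit_int_mxR uL.
  by rewrite d0 expr0n /= => /eqP; rewrite eq_sym oner_eq0.
pose G1 : 'M[R]_(1 + m) := L%:MR^T *m G *m L%:MR.
have pG1 : posdef G1 := posdef_congr uLR pG.
have q1 (z : 'cV[int]_m.+1) : qform G1 z%:MR = qform G (L *m z)%:MR.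
  by rewrite /G1 qform_congr mapR_mul.
have Lz (z : 'cV[int]_m.+1) : z != 0 -> L *m z != 0.
  by apply: contraNneq => /(congr1 (mulmx (invmx L))); rewrite mulKmx // mulmx0 => ->.
have sep1 : lattice_sep G1 c by move=> z z0; rewrite q1; apply/sepG/Lz.
have g1E : G1 0 0 = qform G (col 0 L)%:MR.
  rewrite colE -q1 map_delta_mx /qform trmx_delta -rowE -colE !mxE //.
have det1 : \det G1 = \det G.
  rewrite /G1 !det_mulmx det_tr mulrAC -expr2 unit_int_mxR ?mul1r //.
have g0 := schur_corner_gt0 pG1.
have sepg : lattice_sep G1 (G1 0 0 / 2).
  move=> z z0; rewrite q1; have := hp _ (Lz _ z0).
  rewrite pE map_mxZ /= qformZ -g1E.
  have : 1 <= k%:~R ^+ 2 :> R.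
    by rewrite -rmorphXn /= -[1]/(1%:~R) ler_int expr2; nia.
  move=> k1; have : G1 0 0 <= k%:~R ^+ 2 * G1 0 0 by rewrite ler_peMl // ltW.
  lra.
have gc : c <= G1 0 0.
  rewrite g1E; apply: sepG; apply: contraNneq p0 => cL; rewrite pE cL scaler0 //.
have detS : \det (schur G1) <= `|V| / c.
  rewrite ler_pdivlMr //; apply: le_trans (_ : \det G1 <= _); last first.
    by rewrite det1 (le_trans detG) // ler_norm.
  by rewrite (det_schur pG1) mulrC ler_pM2r // posdef_det_gt0 //; exact: posdef_schur.
have [sepS covS] := covered_step D pG1 sepg.
have cS : lattice_covered (schur G1) D.
  apply: HD => //; first exact: posdef_schur.
  by move=> z z0; apply: le_trans (sepS z z0); rewrite ler_pM2r.
have gub : G1 0 0 <= `|V| + 16 * `|D|.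
  by apply: corner_bound; rewrite ?det1.
move=> x; have [z hz] := covS cS (invmx L%:MR *m x).
exists (L *m z).
have -> : x - (L *m z)%:MR = L%:MR *m (invmx L%:MR *m x - z%:MR).
  by rewrite mulmxBr mulKVmx // mapR_mul.
rewrite -qform_congr; apply: le_trans hz _; rewrite lerD2r ler_pM2r //.
Qed.
End Covering.

(** * Determinants and integer matrices *)

Section IntegerMatrices.
Variable R : realType.

Local Notation "z %:MR" := (map_mx (intr : int -> R) z) (at level 2, format "z %:MR").

Lemma normr_det_le m (M : 'M[R]_m) (c : 'I_m -> R) :
  (forall i j, `|M i j| <= c j) -> `|\det M| <= m`!%:R * \prod_j c j.
Proof.
move=> Mc; apply: le_trans (ler_norm_sum _ _ _) _.
apply: le_trans (_ : \sum_(s : 'S_m) \prod_j c j <= _); last first.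
  by rewrite sumr_const card_Sn mulr_natl.
apply: ler_sum => s _; rewrite normrM normrX normrN1 expr1n mul1r normr_prod.
rewrite [leRHS](reindex_inj (@perm_inj _ s)).
by apply: ler_prod => i _; rewrite normr_ge0 Mc.
Qed.

Lemma normr_det_le_exp m (M : 'M[R]_m) (c : R) :
  (forall i j, `|M i j| <= c) -> `|\det M| <= m`!%:R * c ^+ m.
Proof. by move/normr_det_le; rewrite prodr_const card_ord. Qed.

Lemma diag_dominant_det_neq0 m (M : 'M[R]_m) (b e : R) :
  (forall i j, `|M i j - b *+ (i == j)| <= e) -> m%:R * e < b -> \det M != 0.
Proof.
move=> Me meb; rewrite -unitfE -unitmxE -unitmx_tr; apply: contraLR meb => nu; rewrite -leNgt.
have [v v0 Mv] : exists2 v : 'rV[R]_m, v != 0 & v *m M^T = 0.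
  have /rowV0Pn[v vk v0] : kermx M^T != 0.
    by rewrite kermx_eq0 row_free_unit.
  by exists v => //; apply/sub_kermxP.
have [k0 _] : exists k, v 0 k != 0.
  by apply/existsP; apply: contraNT v0 => /existsPn H; apply/eqP/matrixP => i j;
     rewrite ord1 !mxE; apply/eqP; have := H j; rewrite negbK.
pose k := [arg max_(k > k0) `|v 0 k|]%O.
have kmax j : `|v 0 j| <= `|v 0 k|.
  by rewrite /k; case: Order.TotalTheory.arg_maxP => // i _; exact.
have vk : 0 < `|v 0 k|.
  rewrite lt_neqAle normr_ge0 andbT eq_sym; apply: contraNneq v0 => vk0.
  apply/eqP/matrixP => i j; rewrite ord1 mxE; apply/eqP.
  by rewrite -normr_le0 -vk0.
rewrite -(ler_pM2r vk).
have E : \sum_j v 0 j * (M k j - b *+ (k == j)) = - (v 0 k * b).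
  under eq_bigr do rewrite mulrBr.
  rewrite sumrB (_ : \sum_i _ = 0) ?sub0r; last first.
    by have /matrixP /(_ 0 k) := Mv; rewrite !mxE => {2}<-; apply: eq_bigr => j _; rewrite mxE.
  rewrite (bigD1 k) //= eqxx big1 ?addr0 // => j jk.
  by rewrite eq_sym (negbTE jk) mulr0n mulr0.
have : `|v 0 k * b| <= m%:R * e * `|v 0 k|.
  rewrite -normrN -E; apply: le_trans (ler_norm_sum _ _ _) _.
  have -> : m%:R * e * `|v 0 k| = \sum_(j < m) e * `|v 0 k|.
    by rewrite sumr_const card_ord -mulrA mulr_natl.
  apply: ler_sum => j _; rewrite normrM mulrC.
  by apply: ler_pM.
by apply: le_trans; rewrite normrM mulrC ler_wpM2l // ler_norm.
Qed.

Lemma det_intmx_ge1 m (P : 'M[int]_m) : \det P%:MR != 0 -> 1 <= `|\det P%:MR|.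
Proof.
rewrite det_map_mx /= intr_eq0 => d0; rewrite -intr_norm -[1]/(1%:~R) ler_int.
by move: (\det P) d0 => d; lia.
Qed.

Definition replace_col m (T : Type) (M : 'M[T]_m) (j : 'I_m) (x : 'cV[T]_m) : 'M[T]_m :=
  \matrix_(i, k) if k == j then x i 0 else M i k.

(** Cramer's rule. *)
Lemma replace_col_adj m (M : 'M[R]_m) j (x : 'cV[R]_m) :
  \det (replace_col M j x) = (\adj M *m x) j 0.
Proof.
rewrite (expand_det_col _ j) mxE; apply: eq_bigr => i _.
rewrite !mxE eqxx mulrC; congr (_ * _); congr (_ * \det _).
by apply/matrixP => k l; rewrite !mxE eq_sym (negbTE (neq_lift _ _)).
Qed.

Lemma mul_replace_col m (B : 'M[R]_m) (P : 'M[int]_m) j (z : 'cV[int]_m) :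
  B *m (replace_col P j z)%:MR = replace_col (B *m P%:MR) j (B *m z%:MR).
Proof.
apply/matrixP => i k; rewrite !mxE; case: eqVneq => [->|kj].
  by apply: eq_bigr => l _; rewrite !mxE eqxx.
by apply: eq_bigr => l _; rewrite !mxE (negbTE kj).
Qed.

(** Steinitz exchange in determinant form, as the adjugate of M is injective. *)
Lemma exchange_col m (M : 'M[R]_m) (x : 'cV[R]_m) :
  \det M != 0 -> x != 0 -> exists j, \det (replace_col M j x) != 0.
Proof.
move=> M0 x0; apply/existsP; apply: contraNT x0 => /existsPn H.
have ad0 : \adj M *m x = 0.
  apply/matrixP => j i; rewrite ord1 -replace_col_adj mxE.
  by apply/eqP; have := H j; rewrite negbK.
have := congr1 (mulmx M) ad0; rewrite mulmx0 mulmxA mul_mx_adj mul_scalar_mx => /eqP.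
by rewrite scaler_eq0 (negbTE M0).
Qed.

Section Covered.
Variables (m : nat) (B : 'M[R]_m) (e : R).
Hypothesis e0 : 0 < e.
Hypothesis cov : forall y : 'cV[R]_m, exists z : 'cV[int]_m,
  forall i, `|(y - B *m z%:MR) i 0| <= e.

Let K : R := m.+2%:R * e.

Let near_scalar : exists P : 'M[int]_m, \det (B *m P%:MR) != 0 /\
  forall i j, `|(B *m P%:MR) i j| <= K.
Proof.
(* Nearby lattice vectors differ by at most e in each of the m coordinates, so
   (m + 1) e on the diagonal dominates the rows. *)
pose b : R := m.+1%:R * e.
have /choice[z hz] := fun j : 'I_m => cov (b *: delta_mx j 0).
pose P : 'M[int]_m := \matrix_(i, j) z j i 0.
have HP i j : `|(B *m P%:MR) i j - b *+ (i == j)| <= e.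
  have := hz j i; rewrite !mxE eqxx andbT -normrN opprB.
  rewrite (_ : \sum_j0 _ = \sum_j0 B i j0 * P%:MR j0 j); last first.
    by apply: eq_bigr => k _; rewrite !mxE.
  by case: (i == j); rewrite ?mulr1 ?mulr0.
exists P; split.
  by apply: diag_dominant_det_neq0 HP _; rewrite /b -natr1 mulrDl mul1r ltrDl.
move=> i j; have := HP i j; have b0 : 0 < b by rewrite /b mulr_gt0.
have -> : K = b + e by rewrite /K /b -natr1 mulrDl mul1r.
case: (i == j); rewrite ?mulr1n ?mulr0n ?subr0 !ler_norml; lra.
Qed.

(** The lattice vectors closest to large multiples of the canonical basis form a
    diagonally dominant matrix, whose determinant is a nonzero integer multiple of
    the covolume. *)
Lemma covered_det_le : `|\det B| <= m`!%:R * K ^+ m.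
Proof.
have [P [P0 PK]] := near_scalar; apply: le_trans (normr_det_le_exp PK).
move: P0; rewrite det_mulmx mulf_eq0 negb_or => /andP[_ P0].
by rewrite normrM ler_peMr // det_intmx_ge1.
Qed.

(** Exchanging a short lattice vector with a column of the diagonally dominant
    matrix keeps the determinant a nonzero multiple of the covolume, while that
    column becomes small. *)
Lemma covered_short_vector (z : 'cV[int]_m) (x : R) : B *m z%:MR != 0 ->
  (forall i, `|(B *m z%:MR) i 0| <= x) ->
  `|\det B| <= m`!%:R * (x * K ^+ m.-1).
Proof.
move=> z0 hx; have [P [P0 PK]] := near_scalar.
have [j hj] := exchange_col P0 z0.
have -> : x * K ^+ m.-1 = \prod_k (if k == j then x else K).
  rewrite (bigD1 j) //= eqxx (eq_bigr (fun=> K)); last by move=> k /negbTE ->.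
  by rewrite prodr_const cardC1 card_ord.
apply: (@le_trans _ _ `|\det (replace_col (B *m P%:MR) j (B *m z%:MR))|); last first.
  by apply: normr_det_le => i k; rewrite mxE; case: ifP.
move: hj; rewrite -mul_replace_col det_mulmx mulf_eq0 negb_or => /andP[_ Q0].
by rewrite normrM ler_peMr // det_intmx_ge1.
Qed.

End Covered.

(** Lattice vectors of bounded norm have bounded integer coordinates, so the
    minimum is taken over a finite type. *)
Lemma lattice_shortest_succ m (B : 'M[R]_m.+1) : B \in unitmx ->
  exists2 z0 : 'cV[int]_m.+1, z0 != 0 & forall z : 'cV[int]_m.+1, z != 0 ->
    \sum_i (B *m z0%:MR) i 0 ^+ 2 <= \sum_i (B *m z%:MR) i 0 ^+ 2.
Proof.
move=> uB; pose N (z : 'cV[int]_m.+1) := \sum_i (B *m z%:MR) i 0 ^+ 2.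
pose K := N (const_mx 1).
pose C := \sum_i \sum_j `|invmx B i j| * (1 + K).
have N0 z : 0 <= N z by apply: sumr_ge0 => i _; exact: sqr_ge0.
have hC z i : N z <= K -> `|(z i 0)%:~R| <= C.
  move=> NK; have -> : (z i 0)%:~R = (invmx B *m (B *m z%:MR)) i 0 by rewrite mulKmx // mxE.
  have hB j : `|(B *m z%:MR) j 0| <= 1 + K.
    have : `|(B *m z%:MR) j 0| ^+ 2 <= K.
      apply: le_trans NK; rewrite /N (bigD1 j) //= real_normK ?num_real //.
      by rewrite lerDl sumr_ge0 // => k _; exact: sqr_ge0.
    by have := normr_ge0 ((B *m z%:MR) j 0); move: (`|_|) => t; nra.
  rewrite mxE; apply: le_trans (ler_norm_sum _ _ _) _.
  rewrite /C [leRHS](bigD1 i) //= -[leLHS]addr0; apply: lerD.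
    by apply: ler_sum => j _; rewrite normrM ler_wpM2l.
  by apply: sumr_ge0 => k _; apply: sumr_ge0 => j _; rewrite mulr_ge0 // addr_ge0 // N0.
(* Coordinates in ]-L, L[ are coded by the ordinals below 2 L + 1. *)
pose L := Num.bound C.
have hL z i : N z <= K -> `|z i 0| < L%:Z.
  move=> /(hC z i) h; have C0 : 0 <= C by exact: le_trans h.
  have := le_lt_trans h (archi_boundP C0).
  by rewrite -intr_norm -[X in _ < X -> _]/((L%:Z)%:~R) ltr_int.
pose dec (f : {ffun 'I_m.+1 -> 'I_(L.*2.+1)}) : 'cV[int]_m.+1 := \col_i ((f i)%:Z - L%:Z).
have decP z : N z <= K -> exists f, dec f = z.
  move=> /hL h; exists [ffun i => inord (absz (z i 0 + L%:Z))].
  apply/matrixP => i j; rewrite ord1 mxE ffunE inordK.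
    by have := h i; lia.
  by have := h i; lia.
have [f1 f1E] := decP (const_mx 1) (lexx _).
have c1 : const_mx 1 != 0 :> 'cV[int]_m.+1.
  by apply/eqP => /matrixP /(_ 0 0); rewrite !mxE.
have P1 : dec f1 != 0 by rewrite f1E.
pose nz f := dec f != 0.
case: (@Order.TotalTheory.arg_minP _ _ _ f1 nz (fun f => N (dec f)) P1) => f f0 fmin.
exists (dec f) => // z z0; have [zK|/ltW zK] := leP (N z) K.
  by have [g gE] := decP z zK; have := fmin g; rewrite /nz gE => /(_ z0).
by apply: le_trans zK; rewrite /K -f1E; exact: fmin.
Qed.

Lemma lattice_shortest m (B : 'M[R]_m) : (0 < m)%N -> B \in unitmx ->
  exists2 z0 : 'cV[int]_m, z0 != 0 & forall z : 'cV[int]_m, z != 0 ->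
    \sum_i (B *m z0%:MR) i 0 ^+ 2 <= \sum_i (B *m z%:MR) i 0 ^+ 2.
Proof. by case: m B => // m B _; exact: lattice_shortest_succ. Qed.

End IntegerMatrices.

(** * Spectrum of a real skew-symmetric matrix *)

Section SkewSpectrum.
Variable R : realType.
Local Notation C := (complex R).
Local Notation toC := (map_mx (real_complex R)).

Lemma toC_conj m p (M : 'M[R]_(m, p)) : map_mx conjc (toC M) = toC M.
Proof. by apply/matrixP => i j; rewrite !mxE conjc_real. Qed.

(** With w the conjugate transpose of the eigenvector v, the number v T w = z |v|^2
    is the opposite of its own conjugate. *)
Lemma skew_eigen_imaginary m (T : 'M[R]_m) (z : C) :
  T^T = - T -> root (char_poly (toC T)) z -> z = Complex 0 (complex.Im z).
Proof.
move=> skT; rewrite -eigenvalue_root_char => /eigenvalueP[v vT v0].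
pose w := (map_mx conjc v)^T.
pose N := (v *m w) 0 0.
have NE : N = \sum_j `|v 0 j| ^+ 2.
  by rewrite /N mxE; apply: eq_bigr => j _; rewrite sqr_normc !mxE.
have N0 : N != 0.
  apply: contraNneq v0 => N0; apply/eqP/matrixP => i j; rewrite ord1 mxE.
  move: NE; rewrite N0 => /esym/eqP; rewrite psumr_eq0; last first.
    by move=> k _; rewrite exprn_ge0.
  by move/allP => /(_ j); rewrite mem_index_enum expf_eq0 normr_eq0 => /(_ isT) /eqP.
have E1 : (v *m toC T *m w) 0 0 = z * N by rewrite vT -scalemxAl mxE.
have cw : map_mx conjc w = v^T.
  by apply/matrixP => i j; rewrite !mxE conjcK.
have E2 : conjc ((v *m toC T *m w) 0 0) = - (v *m toC T *m w) 0 0.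
  have -> : conjc ((v *m toC T *m w) 0 0) =
      (map_mx conjc (v *m toC T *m w)) 0 0 by rewrite [RHS]mxE.
  have -> : map_mx conjc (v *m toC T *m w) = (v *m (toC T)^T *m w)^T.
    by rewrite !map_mxM /= toC_conj cw !trmx_mul trmxK mulmxA /w trmxK.
  have -> : (toC T)^T = - toC T by rewrite map_trmx skT map_mxN.
  by rewrite mulmxN mulNmx linearN /= !mxE.
have cN : conjc N = N.
  rewrite NE rmorph_sum; apply: eq_bigr => j _.
  by rewrite sqr_normc rmorphM /= conjcK mulrC.
move: E2; rewrite E1 rmorphM /= cN -mulNr => /(mulIf N0).
by case: z {vT E1} => a b /= [h]; congr (Complex _ _); lra.
Qed.

Lemma char_poly_toC_conj m (T : 'M[R]_m) :
  map_poly conjc (char_poly (toC T)) = char_poly (toC T).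
Proof. by rewrite map_char_poly /= toC_conj. Qed.

(** The roots are imaginary and nonzero, and form a multiset invariant under
    conjugation since the polynomial is real; hence they come in opposite pairs. *)
Lemma skew_char_poly_split m (T : 'M[R]_m) : T^T = - T -> T \in unitmx ->
  exists s : seq R, [/\ all (fun x => 0 < x) s, m = (size s + size s)%N &
    char_poly (toC T) = \prod_(x <- s) (('X - (Complex 0 x)%:P) * ('X - (Complex 0 (- x))%:P))].
Proof.
move=> skT uT; have [rs] := closed_field_poly_normal (char_poly (toC T)).
rewrite (monicP (char_poly_monic _)) scale1r => pE.
have rE z : z \in rs -> z = Complex 0 (complex.Im z).
  by move=> zr; apply: (skew_eigen_imaginary skT); rewrite pE root_prod_XsubC.
have r0 z : z \in rs -> complex.Im z != 0.
  move=> zr; apply: contraTneq uT => z0.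
  have : root (char_poly (toC T)) 0.
    by rewrite (_ : 0 = z) ?pE ?root_prod_XsubC // (rE z zr) z0.
  rewrite -eigenvalue_root_char /eigenvalue /eigenspace => h.
  apply: contraNN h; rewrite raddf0 subr0 kermx_eq0 row_free_unit map_unitmx //.
pose ys := map (@complex.Im R) rs.
have pys : char_poly (toC T) = \prod_(y <- ys) ('X - (Complex 0 y)%:P).
  by rewrite pE big_map; apply: eq_big_seq => z /rE {1}->.
have y0 y : y \in ys -> y != 0 by move=> /mapP[z zr ->]; exact: r0.
clearbody ys; have symm : perm_eq ys (map -%R ys).
  have : \prod_(z <- [seq Complex 0 y | y <- ys]) ('X - z%:P) =
         \prod_(z <- [seq Complex 0 (- y) | y <- ys]) ('X - z%:P).
    rewrite [LHS]big_map [RHS]big_map -pys -[LHS]char_poly_toC_conj pys rmorph_prod /=.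
    by apply: eq_bigr => y _; rewrite rmorphB /= map_polyX map_polyC /=.
  move=> /prod_XsubC_eq /(perm_map (@complex.Im R)).
  by rewrite -!map_comp /= map_id.
pose pos := [seq y <- ys | 0 < y].
have posP : perm_eq ys (pos ++ map -%R pos).
  have fneg : perm_eq [seq y <- ys | ~~ (0 < y)] (map -%R pos).
    apply: perm_trans (perm_filter _ symm) _.
    rewrite filter_map; apply/perm_map; rewrite /pos.
    rewrite (eq_in_filter (a2 := fun y => 0 < y)) // => y yy /=.
    by rewrite oppr_gt0 -leNgt le_eqVlt eq_sym (negbTE (y0 _ yy)).
  by rewrite -(perm_filterC (fun y => 0 < y)) perm_cat2l.
exists pos; split.
- by apply/allP => y; rewrite mem_filter => /andP[].
- have := size_char_poly (toC T); rewrite pys size_prod_XsubC => -[<-].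
  by rewrite (perm_size posP) size_cat size_map.
- by rewrite pys (perm_big _ posP) big_cat big_map big_split.
Qed.

(** Both sides compute the trace of T^2, up to a sign and a factor: as T is skew,
    the value of the characteristic polynomial of T^2 at X^2 is det (X - T) det (X + T),
    the square of the characteristic polynomial of T. *)
Lemma skew_trace_sqr m (T : 'M[R]_m) (s : seq R) : T^T = - T ->
  char_poly (toC T) = \prod_(x <- s) (('X - (Complex 0 x)%:P) * ('X - (Complex 0 (- x))%:P)) ->
  \sum_i \sum_k T i k ^+ 2 = 2 * \sum_(x <- s) x ^+ 2.
Proof.
move=> skT pE; pose D := \prod_(x <- s) ('X - (- (x ^+ 2))%:P) : {poly R}.
have [m0|m0] := posnP m.
  have : size (char_poly (toC T)) = 1%N by rewrite size_char_poly m0.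
  rewrite pE; case: (s) => [|x l].
    rewrite !big_nil mulr0 big1 // => i _.
    by exfalso; have := leq_ltn_trans (leq0n i) (ltn_ord i); rewrite m0.
  rewrite big_split /=.
  rewrite -(big_map (fun x => Complex 0 x) xpredT (fun z => 'X - z%:P)).
  rewrite -(big_map (fun x => Complex 0 (- x)) xpredT (fun z => 'X - z%:P)).
  rewrite size_mul ?size_prod_XsubC ?monic_neq0 ?monic_prod_XsubC //.
  by rewrite /= !addSn !addnS.
have cpT : char_poly T = D \Po 'X^2.
  apply: (map_poly_inj (real_complex R)); rewrite map_char_poly pE.
  rewrite map_comp_poly /= map_polyXn !rmorph_prod; apply: eq_bigr => x _ /=.
  rewrite rmorphB /= map_polyX map_polyC /= rmorphB /= comp_polyX comp_polyC.
  have -> : Complex 0 (- x) = - Complex 0 x.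
    by apply/eqP; rewrite eq_complex /= oppr0 !eqxx.
  have -> : (- (x ^+ 2))%:C%C = Complex 0 x * Complex 0 x.
    by apply/eqP; rewrite eq_complex /= !mul0r !mulr0 addr0 sub0r expr2 !eqxx.
  by rewrite polyCN opprK polyCM; ring.
have q2 : char_poly (T *m T) \Po 'X^2 = char_poly T * char_poly T.
  rewrite /char_poly -det_map_mx -[X in _ = _ * X]det_tr -det_mulmx; congr (\det _).
  have -> : (char_poly_mx T)^T = 'X%:M + map_mx polyC T.
    by rewrite /char_poly_mx linearB /= tr_scalar_mx map_trmx skT map_mxN opprK.
  rewrite /char_poly_mx map_mxB /= map_scalar_mx /= comp_polyX.
  have XC : map_mx polyC T *m 'X%:M = 'X%:M *m map_mx polyC T.
    by rewrite scalar_mxC.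
  rewrite mulmxDr !mulmxBl XC -scalar_mxM -expr2.
  rewrite addrA subrK; congr (_ - _).
  by rewrite -!map_mxM; apply/matrixP => i j; rewrite !mxE comp_polyC.
have qE : char_poly (T *m T) = D * D.
  apply/eqP; rewrite -subr_eq0 -(@comp_poly_eq0 _ _ 'X^2) ?size_polyXn //.
  by rewrite rmorphB /= q2 cpT rmorphM /= subrr.
have := char_poly_trace (T *m T) m0.
pose l := [seq - (x ^+ 2) | x <- s].
have qE' : char_poly (T *m T) = \prod_(y <- l ++ l) ('X - y%:P).
  by rewrite qE big_cat big_map.
have sz : m = size (l ++ l).
  by have := size_char_poly (T *m T); rewrite qE' size_prod_XsubC => -[].
rewrite qE' (_ : m.-1 = (size (l ++ l)).-1) -?sz // {1}sz coefPn_prod_XsubC; last first.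
  by have := size_char_poly (T *m T); rewrite qE' size_prod_XsubC => -[->]; rewrite -lt0n.
move=> /oppr_inj; rewrite big_cat /= !big_map sumrN -opprD => /(congr1 -%R).
rewrite opprK mulr2n mulrDl mul1r => ->.
rewrite /mxtrace -sumrN; apply: eq_bigr => i _; rewrite mxE -sumrN.
apply: eq_bigr => k _; have /matrixP /(_ i k) := skT; rewrite !mxE => ->.
by rewrite expr2 mulrN opprK.
Qed.

End SkewSpectrum.

(** * The operator of the symplectic form *)

Section Symplectic.
Variables (R : realType) (n : nat).
Implicit Types (A : 'M[R]_(n + n)) (u v : 'cV[R]_(n + n)).

Local Notation J := (Jn R n).
Local Notation toC := (map_mx (real_complex R)).

(** Matrix of the form omega([U, V]) in an orthonormal basis of the metric given
    by A, namely the columns of A. *)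
Definition omega_mx A : 'M[R]_(n + n) := A^T *m J *m A.

Lemma Jn_skew : J^T = - J.
Proof.
by rewrite /Jn tr_block_mx !trmx0 linearN /= trmx1 opp_block_mx oppr0 opprK.
Qed.

Lemma omega_mx_skew A : (omega_mx A)^T = - omega_mx A.
Proof. by rewrite /omega_mx !trmx_mul trmxK Jn_skew mulNmx mulmxN mulmxA. Qed.

Lemma Jn_sqr : J *m J = - 1%:M.
Proof.
rewrite /Jn mulmx_block !mul0mx !mulmx0 !mulmx1 !mul1mx !add0r !addr0.
by rewrite (scalar_mx_block n n (1 : R)) opp_block_mx !oppr0.
Qed.

Lemma det_Jn_sqr : \det J ^+ 2 = 1.
Proof.
rewrite expr2 -det_mulmx Jn_sqr -scaleN1r detZ det1 mulr1.
by rewrite -signr_odd addnn odd_double expr0.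
Qed.

Lemma normr_det_Jn : `|\det J| = 1.
Proof.
apply/eqP; rewrite -(@eqrXn2 _ 2) // ?normr_ge0 // real_normK ?num_real //.
by rewrite det_Jn_sqr expr1n.
Qed.

Lemma normr_det_omega_mx A : `|\det (omega_mx A)| = `|\det A| ^+ 2.
Proof. by rewrite /omega_mx !det_mulmx det_tr !normrM normr_det_Jn mulr1. Qed.

Lemma omega_mx_unit A : A \in unitmx -> omega_mx A \in unitmx.
Proof.
move=> uA; have uJ : J \in unitmx.
  by rewrite unitmxE unitfE -normr_eq0 normr_det_Jn oner_eq0.
by rewrite /omega_mx !unitmx_mul unitmx_tr uA uJ.
Qed.

Lemma omega_bracketE u v :
  omega (bracket (vincl u) (vincl v)) = (u^T *m J *m v) 0 0.
Proof.
have -> : u^T *m J *m v =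
    (usubmx u)^T *m dsubmx v - (dsubmx u)^T *m usubmx v.
  rewrite -{1}(vsubmxK u) -{1}(vsubmxK v) tr_col_mx mul_row_block mul_row_col.
  by rewrite !mulmx0 mulmxN !mulmx1 add0r addr0 mulNmx addrC.
rewrite /omega /bracket !mxE !eqxx mulr1 -sumrB; apply: eq_bigr => i _.
by rewrite /vincl /iX /iY !col_mxEu !mxE.
Qed.

Lemma scalAE A u v : scalA A u v = ((invmx A *m u)^T *m (invmx A *m v)) 0 0.
Proof. by rewrite /scalA /dotprod mxE; apply: eq_bigr => i _; rewrite !mxE. Qed.

Definition jA A : 'M[R]_(n + n) := A *m (- omega_mx A) *m invmx A.

Lemma mulmx_bilin_inj m (M N : 'M[R]_m) :
  (forall x y : 'cV[R]_m, (x^T *m M *m y) 0 0 = (x^T *m N *m y) 0 0) -> M = N.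
Proof.
move=> H; apply/matrixP => i j; have := H (delta_mx i 0) (delta_mx j 0).
by rewrite !trmx_delta -!rowE -!colE !mxE.
Qed.

Lemma is_jA_jA A : A \in unitmx -> is_jA A (jA A).
Proof.
move=> uA u v; rewrite scalAE omega_bracketE; congr (fun_of_matrix _ 0 0).
have -> : invmx A *m (jA A *m u) = - omega_mx A *m (invmx A *m u).
  by rewrite /jA -!mulmxA mulKmx.
rewrite trmx_mul linearN /= omega_mx_skew opprK trmx_mul /omega_mx trmx_inv.
by rewrite !mulmxA mulmxKV ?unitmx_tr // mulmxK.
Qed.

(** The scalar product is nondegenerate. *)
Lemma is_jA_uniq A j : A \in unitmx -> is_jA A j -> j = jA A.
Proof.
move=> uA hj; have hjA := is_jA_jA uA.
have E : (invmx A *m j)^T = (invmx A *m jA A)^T.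
  suff : (invmx A *m j)^T *m invmx A = (invmx A *m jA A)^T *m invmx A.
    by move/(congr1 (mulmxr A)) => /=; rewrite !mulmxKV.
  apply: mulmx_bilin_inj => x y.
  have := etrans (hj x y) (esym (hjA x y)); rewrite !scalAE.
  rewrite (mulmxA (invmx A) j) (mulmxA (invmx A) (jA A)).
  by rewrite (trmx_mul (invmx A *m j)) (trmx_mul (invmx A *m jA A)) !mulmxA.
by move/trmx_inj/(congr1 (mulmx A)): E; rewrite !mulKVmx.
Qed.

(** In the orthonormal basis given by the columns of A, the operator is the opposite
    of omega_mx A. *)
Lemma char_poly_jA A : A \in unitmx ->
  char_poly (toC (jA A)) = char_poly (toC (- omega_mx A)).
Proof.
move=> uA; rewrite -!map_char_poly; congr (map_poly _ _).
rewrite /char_poly.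
have -> : char_poly_mx (jA A) =
  map_mx polyC A *m char_poly_mx (- omega_mx A) *m map_mx polyC (invmx A).
  rewrite /char_poly_mx mulmxBr mulmxBl /jA !map_mxM; congr (_ - _).
  by rewrite scalar_mxC -mulmxA -map_mxM mulmxV // map_mx1 mulmx1.
rewrite !det_mulmx mulrAC -det_mulmx -map_mxM mulmxV // map_mx1 det1 mul1r //.
Qed.

Lemma dtuple_exists A : A \in unitmx -> exists d, is_dtuple A d.
Proof.
move=> uA; have skT : (- omega_mx A)^T = - - omega_mx A.
  by rewrite linearN /= omega_mx_skew.
have uT : - omega_mx A \in unitmx.
  have := omega_mx_unit uA; rewrite !unitmxE -scaleN1r detZ unitrM => ->.
  by rewrite andbT unitrX // unitrN1.
have [s [s0 ns pE]] := skew_char_poly_split skT uT.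
have sz0 : size s = n by move: ns; rewrite !addnn => /double_inj.
have sz : size (sort <=%R s) == n by rewrite size_sort sz0.
exists (Tuple sz); split.
- exact: sort_sorted (@le_total _ R) s.
- by rewrite /= all_sort.
- exists (jA A); first exact: is_jA_jA.
  rewrite char_poly_jA // pE -(big_tuple _ _ (Tuple sz) xpredT
    (fun x => ('X - (Complex 0 x)%:P) * ('X - (Complex 0 (- x))%:P))) /=.
  by apply/perm_big; rewrite perm_sym perm_sort.
Qed.

Lemma dtuple_sum_sqr A (d : n.-tuple R) : A \in unitmx -> is_dtuple A d ->
  \sum_i \sum_k omega_mx A i k ^+ 2 = 2 * \sum_(x <- d) x ^+ 2.
Proof.
move=> uA [_ _ [j hj pE]]; move: pE; rewrite (is_jA_uniq uA hj) char_poly_jA //.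
rewrite -(big_tuple _ _ d xpredT
    (fun x => ('X - (Complex 0 x)%:P) * ('X - (Complex 0 (- x))%:P))).
move=> /skew_trace_sqr <-; last by rewrite linearN /= omega_mx_skew.
apply: eq_bigr => i _; apply: eq_bigr => k _.
by rewrite -[RHS]sqrrN; congr (_ ^+ 2); rewrite [in RHS]mxE opprK.
Qed.

End Symplectic.

(** * Popp's volume *)

(** Each iteration peels off one side, the indicator of a box being a product. *)
Lemma lebesgue_int_box (R : realType) m (w : 'I_m -> R) (rho : R) :
  (forall i, 0 <= w i) ->
  lebesgue_int (fun x : 'cV[R]_m =>
     (rho * \1_[set x : 'cV[R]_m | forall i, 0 <= x i 0 < w i] x)%:E) =
  (rho * \prod_i w i)%:E.
Proof.
elim: m w rho => [|m IH] w rho w0 /=.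
  rewrite big_ord0 indicE mem_set //; by case.
pose w' i := w (lift ord0 i).
transitivity (\int[@lebesgue_measure R]_t
   ((fun=> (rho * \prod_i w' i)%R%:E) \_ `[0%R, w ord0[%classic) t)%E.
  apply: eq_integral => t _.
  rewrite (_ : (fun x : 'cV[R]_m => _) =
    (fun x : 'cV[R]_m => ((rho * \1_(`[0%R, w ord0[%classic : set R) (t : R)) *
     \1_[set x : 'cV[R]_m | forall i, 0 <= x i 0 < w' i] x)%:E)); last first.
    apply/funext => x; rewrite -mulrA; congr ((_ * _)%:E); rewrite !indicE.
    rewrite -natrM mulnb; congr ((_ : bool)%:R).
    rewrite (_ : (t \in _) = (0 <= t < w ord0)); last first.
      by apply/idP/idP; rewrite inE /= in_itv.
    have xE : (col_mx t%:M x : 'cV_m.+1) ord0 0 = t.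
      rewrite (_ : (@ord0 m) = lshift m (@ord0 0)); last exact: val_inj.
      by rewrite (@col_mxEu _ 1 m 1 t%:M x) mxE eqxx mulr1n.
    apply/idP/andP => [|[t0]]; rewrite !inE /= => H.
      split; last first.
        move=> i; have := H (lift ord0 i).
        by rewrite -rshift1 (@col_mxEd _ 1 m 1 t%:M x) rshift1.
      by have := H ord0; rewrite xE.
    move=> i; case: (unliftP ord0 i) => [j|] ->.
      by rewrite -rshift1 (@col_mxEd _ 1 m 1 t%:M x) rshift1; exact: H.
    by rewrite xE.
  rewrite IH; last by move=> i; exact: w0.
  rewrite /patch indicE; case: (t \in _); first by rewrite mulr1.
  by rewrite mulr0 mul0r.
rewrite -integral_mkcond integral_cst //= lebesgue_measure_itv /= lte_fin.
rewrite big_ord_recl -EFinD subr0.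
case: ltP => [_|w00]; first by rewrite -EFinM mulrAC mulrA.
have -> : w ord0 = 0 by apply/le_anti; rewrite w00 w0.
by rewrite mule0 mul0r mulr0.
Qed.

Lemma split_lshift m p (i : 'I_m) : fintype.split (lshift p i) = inl i.
Proof. exact: (unsplitK (inl i)). Qed.

Lemma split_rshift m p (i : 'I_p) : fintype.split (rshift m i) = inr i.
Proof. exact: (unsplitK (inr i)). Qed.

Section Popp.
Variables (R : realType) (n : nat).
Local Notation heis := 'cV[R]_(n + n + 1).
Local Notation J := (Jn R n).

Definition dom_side (r : 'I_n -> nat) (i : 'I_(n + n + 1)) : R :=
  match fintype.split i with
  | inl j => match fintype.split j with inl k => (r k)%:R | inr _ => 1 end
  | inr _ => 1
  end.

Lemma quotient_int_cst r (rho : R) :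
  quotient_int r (fun _ : heis => rho) = (rho * (\prod_i (r i)%:R))%:E.
Proof.
rewrite /quotient_int.
have -> : @fund_domain R n r = [set x | forall i, 0 <= x i 0 < dom_side r i].
  apply/seteqP; split => x /=.
    move=> [hX [hY hZ]] i; rewrite /dom_side; case: split_ordP => [j|j] ->.
      by case: split_ordP => k ->; [exact: hX|exact: hY].
    by rewrite ord1.
  move=> H; split=> [i|]; last split=> [i|].
  - by have := H (iX i); rewrite /dom_side /iX !split_lshift.
  - by have := H (iY i); rewrite /dom_side /iY split_lshift split_rshift.
  - by have := H (iZ n); rewrite /dom_side /iZ split_rshift.
rewrite lebesgue_int_box; last first.
  by move=> i; rewrite /dom_side; case: fintype.split => [j|j //]; case: fintype.split.
congr ((_ * _)%:E); rewrite !big_split_ord /= big_ord1 /dom_side split_rshift mulr1.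
rewrite [X in _ * X]big1 ?mulr1; last by move=> i _; rewrite split_lshift split_rshift.
by apply: eq_bigr => i _; rewrite !split_lshift.
Qed.

(** Differential of the left translation by g, a unipotent matrix; this is why the
    density of the volume is constant in these coordinates. *)
Definition left_mx (g : heis) : 'M[R]_(n + n + 1) :=
  block_mx 1%:M 0 (2^-1 *: ((usubmx g)^T *m J)) 1%:M.

Lemma bracketE (x y : heis) :
  bracket x y = ((usubmx x)^T *m J *m usubmx y) 0 0 *: basisZ R n.
Proof.
rewrite -omega_bracketE /omega /bracket !mxE !eqxx mulr1.
by congr (_ *: _); apply: eq_bigr => i _; rewrite /vincl /iX /iY !col_mxEu !mxE.
Qed.

Lemma basisZE : basisZ R n = col_mx 0 1%:M.
Proof.
apply/matrixP => i j; rewrite ord1 /basisZ /iZ mxE andbT.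
case: (split_ordP i) => k ->; first by rewrite col_mxEu mxE eq_lrshift.
by rewrite col_mxEd !mxE !ord1 !eqxx.
Qed.

Lemma dleftE (g u : heis) : dleft g u = left_mx g *m u.
Proof.
rewrite /dleft bracketE basisZE -{1 3}(vsubmxK u) /left_mx mul_block_col.
rewrite !mul1mx mul0mx addr0 scale_col_mx scaler0 scale_col_mx scaler0 add_col_mx addr0.
congr col_mx; rewrite addrC -scalemxAl; congr (_ *: _ + _).
by rewrite scale_scalar_mx mulr1 -mx11_scalar.
Qed.

Lemma mulmx_col m p q (M : 'M[R]_(m, p)) (N : 'M[R]_(p, q)) k :
  M *m col k N = col k (M *m N).
Proof. by rewrite !colE mulmxA. Qed.

Lemma frame_atE (U : 'M[R]_(n + n + 1)) g : frame_at U g = left_mx g *m U.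
Proof.
apply/matrixP => i k; by rewrite mxE dleftE mulmx_col mxE.
Qed.

Lemma det_frame_at (U : 'M[R]_(n + n + 1)) g : \det (frame_at U g) = \det U.
Proof. by rewrite frame_atE det_mulmx det_lblock !det1 !mul1r. Qed.

Definition frob m (M : 'M[R]_m) : R := \sum_i \sum_k M i k ^+ 2.

Lemma frobE m (M : 'M[R]_m) : frob M = \tr (M *m M^T).
Proof.
rewrite /mxtrace; apply: eq_bigr => i _; rewrite mxE; apply: eq_bigr => k _.
by rewrite mxE expr2.
Qed.

Lemma frob_orth m (M Q : 'M[R]_m) : Q^T *m Q = 1%:M -> frob (Q^T *m M *m Q) = frob M.
Proof.
move=> oQ; have oQ' := mulmx1C oQ.
rewrite !frobE !trmx_mul trmxK -!mulmxA (mulmxA Q Q^T) oQ' mul1mx.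
rewrite mxtrace_mulC -!mulmxA oQ' mulmx1 //.
Qed.

Lemma frob_ge0 m (M : 'M[R]_m) : 0 <= frob M.
Proof. by apply: sumr_ge0 => i _; apply: sumr_ge0 => k _; exact: sqr_ge0. Qed.

(** The first columns of U form A Q with Q orthogonal, so the structure constants
    are those of the transpose of Q times omega_mx A times Q, and the Frobenius norm
    forgets Q. The vertical component of the last vector cancels between the
    structure constants and the determinant. *)
Lemma popp_density_cst (A : 'M[R]_(n + n)) (U : 'M[R]_(n + n + 1)) :
  A \in unitmx -> adapted_frame A U ->
  exists rho, (forall g, popp_density U g = rho) /\
    `|rho| = (Num.sqrt (frob (omega_mx A)) * `|\det A|)^-1.
Proof.
move=> uA [uU horU ortU].
pose W : 'M[R]_(n + n) := ulsubmx U.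
pose u : R := U (iZ n) (iZ n).
have colW i : vproj (col (lshift 1 i) U) = col i W.
  by apply/matrixP => k l; rewrite !mxE.
have UE : U = block_mx W (ursubmx U) 0 u%:M.
  rewrite -{1}(submxK U); congr block_mx.
    apply/matrixP => i j; rewrite ord1 !mxE.
    by have := horU j; rewrite /vdistr /omega /= mxE.
  by rewrite [LHS]mx11_scalar; congr (_%:M); rewrite !mxE.
have oQ : (invmx A *m W)^T *m (invmx A *m W) = 1%:M.
  apply/matrixP => i k; have := ortU i k; rewrite !colW scalAE !mulmx_col.
  move=> h; rewrite [RHS]mxE -h tr_col !mxE.
  by apply: eq_bigr => j _; rewrite !mxE.
set Q := invmx A *m W in oQ.
have WE : W = A *m Q by rewrite /Q mulKVmx.
clearbody Q.
have detU : \det U = \det W * u by rewrite UE det_ublock det_scalar expr1.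
have : \det U != 0 by rewrite -unitfE -unitmxE.
rewrite detU mulf_eq0 negb_or => /andP[W0 u0].
have iUZ : invmx U (iZ n) (iZ n) = u^-1.
  have : (U *m invmx U) (iZ n) (iZ n) = 1 by rewrite mulmxV // mxE eqxx.
  rewrite mxE (bigD1 (iZ n)) //= big1 ?addr0 => [h|k kZ].
    by apply: (mulfI u0); rewrite mulfV.
  case: (split_ordP k) kZ => l -> kZ; last by rewrite ord1 eqxx in kZ.
  by rewrite {1}UE /iZ block_mxEdl mxE mul0r.
have invZ : (invmx U *m basisZ R n) (iZ n) 0 = u^-1.
  by rewrite /basisZ -colE mxE.
have sc i k : structure_const U i k = u^-1 * (Q^T *m omega_mx A *m Q) i k.
  rewrite /structure_const bracketE -/(vproj (col (lshift 1 i) U)).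
  rewrite -/(vproj (col (lshift 1 k) U)) !colW -scalemxAr.
  set c := (_ *m _) 0 0; rewrite mxE invZ mulrC; congr (_ * _).
  have -> : Q^T *m omega_mx A *m Q = W^T *m J *m W.
    rewrite /omega_mx WE trmx_mul !mulmxA; reflexivity.
  by rewrite /c mulmx_col tr_col -!row_mul !mxE.
exists ((Num.sqrt (\sum_i \sum_k structure_const U i k ^+ 2))^-1 * (\det U)^-1); split.
  move=> g; rewrite /popp_density det_inv det_frame_at //.
have -> : \sum_i \sum_k structure_const U i k ^+ 2 = u^-1 ^+ 2 * frob (omega_mx A).
  rewrite -(frob_orth _ oQ) /frob mulr_sumr; apply: eq_bigr => i _.
  by rewrite mulr_sumr; apply: eq_bigr => k _; rewrite sc exprMn.
rewrite sqrtrM ?sqr_ge0 // sqrtr_sqr detU WE det_mulmx.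
have dQ : `|\det Q| = 1.
  apply/eqP; rewrite -(@eqrXn2 _ 2) // ?normr_ge0 // real_normK ?num_real //.
  by rewrite expr1n expr2 -{1}det_tr -det_mulmx oQ det1.
rewrite !(normrM, normfV) normr_id dQ mulr1 (ger0_norm (sqrtr_ge0 _)).
rewrite !invfM invrK; have u0' : `|u| != 0 by rewrite normr_eq0.
by move: (Num.sqrt _)^-1 `|\det A|^-1 => x y; field.
Qed.

Definition popp_total (r : 'I_n -> nat) (A : 'M[R]_(n + n)) : R :=
  (Num.sqrt (frob (omega_mx A)) * `|\det A|)^-1 * \prod_i (r i)%:R.

Lemma is_popp_meas_val r A m : A \in unitmx -> is_popp_meas r A m ->
  m = (popp_total r A)%:E.
Proof.
move=> uA [U aU ->]; have [rho [dens rhoE]] := popp_density_cst uA aU.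
have -> : popp_density U = fun=> rho by apply/funext.
rewrite quotient_int_cst abse_EFin normrM rhoE ger0_norm //.
by apply: prodr_ge0.
Qed.

Lemma adapted_frame_exists (A : 'M[R]_(n + n)) : A \in unitmx ->
  adapted_frame A (block_mx A 0 0 1%:M).
Proof.
move=> uA; have colA i : vproj (col (lshift 1 i) (block_mx A 0 0 1%:M)) = col i A.
  by apply/matrixP => k l; rewrite /vproj [LHS]mxE [LHS]mxE block_mxEul [RHS]mxE.
split.
- by rewrite unitmxE det_ublock det1 mulr1 -unitmxE.
- by move=> i; rewrite /vdistr /= /omega mxE /iZ block_mxEdl mxE.
- move=> i k; rewrite !colA scalAE !mulmx_col mulVmx //.
  by rewrite tr_col trmx1 -row_mul mul1mx !mxE.
Qed.

Lemma is_popp_meas_exists r A : A \in unitmx -> is_popp_meas r A (popp_total r A)%:E.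
Proof.
move=> uA; have aU := adapted_frame_exists uA.
suff : is_popp_meas r A `|quotient_int r (popp_density (block_mx A 0 0 1%:M))|%E.
  by move=> h; rewrite -(is_popp_meas_val uA h).
by exists (block_mx A 0 0 1%:M).
Qed.

End Popp.

(** * Horizontal lifts of polynomial curves *)

Section PolynomialCurves.
Variable R : realType.

(** The sup bound and the Lipschitz bound are proved together, the product rule in
    the induction step needing both. *)
Lemma horner_lipschitz01 (p : {poly R}) : exists2 K, 0 <= K &
  forall a b, 0 <= a -> a <= b -> b <= 1 ->
    `|p.[a]| <= K /\ `|p.[b] - p.[a]| <= K * (b - a).
Proof.
elim/poly_ind: p => [|p c [K K0 HK]].
  by exists 0 => // a b *; rewrite !horner0 subrr normr0 mul0r.
exists (2 * K + `|c|) => [|a b a0 ab b1]; first by rewrite addr_ge0 // mulr_ge0.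
have [h1 h2] := HK a b a0 ab b1; rewrite !hornerE; split.
  apply: le_trans (ler_normD _ _) _; rewrite lerD2r normrM (ger0_norm a0).
  have : `|p.[a]| * a <= K * 1 by apply: ler_pM => //; lra.
  lra.
have -> : p.[b] * b + c - (p.[a] * a + c) = (p.[b] - p.[a]) * b + p.[a] * (b - a) by ring.
apply: le_trans (ler_normD _ _) _; rewrite !normrM (ger0_norm (le_trans a0 ab)).
have ba : 0 <= b - a by lra.
rewrite (ger0_norm ba).
have : `|p.[b] - p.[a]| * b <= K * (b - a) * 1 by apply: ler_pM => //; lra.
have : `|p.[a]| * (b - a) <= K * (b - a) by apply: ler_wpM2r.
have : 0 <= `|c| * (b - a) by apply: mulr_ge0.
lra.
Qed.

Variable N : nat.

(** A curve is stored by the polynomials giving its coordinates, so that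
    derivatives are formal and Lipschitz bounds follow from the coefficients. *)
Definition curve_eval (P : 'cV[{poly R}]_N) (t : R) : 'cV[R]_N :=
  map_mx (fun p => p.[t]) P.

Lemma curve_eval_derive (P : 'cV[{poly R}]_N) t :
  derivable (curve_eval P) t 1 /\
  derive1 (curve_eval P) t = curve_eval (map_mx (@deriv R) P) t.
Proof.
have dP : derivable (curve_eval P) t 1.
  apply/derivable_mxP => i j; rewrite (_ : (fun x => _) = horner (P i j)).
    exact: derivable_horner.
  by apply/funext => x; rewrite mxE.
split=> //; rewrite derive1E derive_mx //; apply/matrixP => i j; rewrite !mxE.
rewrite (_ : (fun x => _) = horner (P i j)); last by apply/funext => x; rewrite mxE.
by rewrite derivE derive1E.
Qed.

Lemma curve_eval_lipschitz (P : 'cV[{poly R}]_N) : exists2 K, 0 <= K &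
  forall a b, 0 <= a -> a <= b -> b <= 1 ->
    `|curve_eval P b - curve_eval P a| <= K * (b - a).
Proof.
have /choice[K HK] : forall i, exists K, 0 <= K /\
  forall a b, 0 <= a -> a <= b -> b <= 1 ->
    `|(P i 0).[b] - (P i 0).[a]| <= K * (b - a).
  move=> i; have [K K0 HK] := horner_lipschitz01 (P i 0).
  by exists K; split=> // a b a0 ab b1; have [] := HK a b a0 ab b1.
have S0 : 0 <= \sum_i K i by apply: sumr_ge0 => i _; have [] := HK i.
exists (\sum_i K i) => // a b a0 ab b1.
rewrite /Num.norm /= mx_normrE; apply: bigmax_le => [|[i j] _ /=].
  by rewrite mulr_ge0 // subr_ge0.
rewrite !mxE !ord1; have [Ki h] := HK i; apply: le_trans (h a b a0 ab b1) _.
apply: ler_wpM2r; first by rewrite subr_ge0.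
rewrite (bigD1 i) //= lerDl; apply: sumr_ge0 => k _.
by have [] := HK k.
Qed.

End PolynomialCurves.

Lemma lipschitz_abs_continuous (R : realType) n (c : R -> 'cV[R]_(n + n + 1)) K :
  0 <= K -> (forall a b, 0 <= a -> a <= b -> b <= 1 -> `|c b - c a| <= K * (b - a)) ->
  abs_continuous01 c.
Proof.
move=> K0 HK e e0; have K1 : 0 < K + 1 by lra.
exists (e / (K + 1)); first by rewrite divr_gt0.
move=> m a b ab _; rewrite ltr_pdivlMr // => sm.
apply: le_lt_trans sm; rewrite mulrC mulr_sumr; apply: ler_sum => i _.
have [a0 [abi b1]] := ab i; apply: le_trans (HK _ _ a0 abi b1) _.
apply: ler_wpM2r; lra.
Qed.

Section LoopPolynomials.
Variable R : realType.

(** Equal to t (1 - t) (1 - 2 t): it vanishes at 0 and 1, and is odd about 1/2, so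
    its integral over [0, 1] is zero. *)
Definition loop_odd : {poly R} := 'X - 3%:P * 'X^2 + 2%:P * 'X^3.

(** Equal to s - 5 s^2 for s = t (1 - t): it vanishes at 0 and 1 and has integral
    zero, 1/6 - 5/30, but together with loop_odd it encloses a nonzero area. *)
Definition loop_even : {poly R} := 'X - 6%:P * 'X^2 + 10%:P * 'X^3 - 5%:P * 'X^4.

(** Height of the horizontal lift of t w + loop_odd(t) u + loop_even(t) v, where a, b, c
    are the values of the symplectic form on (w, u), (w, v), (u, v). *)
Definition lift_height (a b c : R) : {poly R} :=
  (a / 2)%:P * ('X^4 - 'X^3) + (b / 2)%:P * (5%:P * 'X^4 - 2%:P * 'X^3 - 3%:P * 'X^5)
  + (c / 2)%:P * (4%:P * 'X^4 - 'X^3 - (33 / 5)%:P * 'X^5 + 5%:P * 'X^6 - (10 / 7)%:P * 'X^7).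

Let polyE := (derivXn, hornerXn, derivC, derivX, hornerC, hornerX, hornerMn,
  derivN, hornerN, derivD, hornerD, derivM, hornerM).

Lemma loop_oddE t : loop_odd.[t] = t - 3 * t ^+ 2 + 2 * t ^+ 3.
Proof. by rewrite /loop_odd !polyE. Qed.

Lemma loop_evenE t : loop_even.[t] = t - 6 * t ^+ 2 + 10 * t ^+ 3 - 5 * t ^+ 4.
Proof. by rewrite /loop_even !polyE. Qed.

Lemma deriv_loop_oddE t : loop_odd^`().[t] = 1 - 6 * t + 6 * t ^+ 2.
Proof. rewrite /loop_odd !polyE /=. ring. Qed.

Lemma deriv_loop_evenE t : loop_even^`().[t] = 1 - 12 * t + 30 * t ^+ 2 - 20 * t ^+ 3.
Proof. by rewrite /loop_even !polyE /=; ring. Qed.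

(** Horizontality of the lift: the height grows at half the symplectic product of
    position and velocity. *)
Lemma deriv_lift_heightE a b c t : (lift_height a b c)^`().[t] =
  2^-1 * (a * (t * loop_odd^`().[t] - loop_odd.[t]) +
          b * (t * loop_even^`().[t] - loop_even.[t]) +
          c * (loop_odd.[t] * loop_even^`().[t] - loop_even.[t] * loop_odd^`().[t])).
Proof.
rewrite deriv_loop_oddE deriv_loop_evenE loop_oddE loop_evenE.
by rewrite /lift_height !polyE /=; field.
Qed.

Lemma lift_height0 a b c : (lift_height a b c).[0] = 0.
Proof. by rewrite /lift_height !polyE !expr0n /=; field. Qed.

(** The terms mixing w with the loop vanish because both loop polynomials have
    integral zero; what remains is the area enclosed by the loop. *)
Lemma lift_height1 a b c : (lift_height a b c).[1] = - c / 70.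
Proof. by rewrite /lift_height !polyE !expr1n; field. Qed.

End LoopPolynomials.

Section SymplecticForm.
Variables (R : realType) (n : nat).
Local Notation vec := 'cV[R]_(n + n).

Definition symp (x y : vec) : R := (x^T *m Jn R n *m y) 0 0.

Lemma symp_skew x y : symp y x = - symp x y.
Proof.
rewrite /symp -!omega_bracketE /omega /bracket !mxE eqxx !mulr1 -sumrN.
by apply: eq_bigr => i _; ring.
Qed.

Lemma symp_self x : symp x x = 0.
Proof. by have := symp_skew x x; lra. Qed.

Lemma sympDl x y z : symp (x + y) z = symp x z + symp y z.
Proof. by rewrite /symp linearD /= !mulmxDl mxE. Qed.

Lemma sympDr x y z : symp z (x + y) = symp z x + symp z y.
Proof. by rewrite /symp mulmxDr mxE. Qed.

Lemma sympZl a x z : symp (a *: x) z = a * symp x z.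
Proof. by rewrite /symp linearZ /= -!scalemxAl mxE. Qed.

Lemma sympZr a x z : symp z (a *: x) = a * symp z x.
Proof. by rewrite /symp -!scalemxAr mxE. Qed.

Lemma sympNl x z : symp (- x) z = - symp x z.
Proof. by rewrite -scaleN1r sympZl mulN1r. Qed.

Lemma symp0l x : symp 0 x = 0.
Proof. by rewrite -[in LHS](scale0r 0) sympZl mul0r. Qed.

Lemma symp0r x : symp x 0 = 0.
Proof. by rewrite -[in LHS](scale0r 0) sympZr mul0r. Qed.

Lemma bracket_symp x y : bracket x y = symp (usubmx x) (usubmx y) *: basisZ R n.
Proof. exact: bracketE. Qed.

End SymplecticForm.

Section LiftedCurve.
Variables (R : realType) (n : nat).
Local Notation heis := 'cV[R]_(n + n + 1).
Local Notation J := (Jn R n).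
Variables (g : heis) (w u v : 'cV[R]_(n + n)).

Local Notation om := (@symp R n).
Local Notation p := (loop_odd R).
Local Notation q := (loop_even R).
Local Notation zeta := (lift_height (om w u) (om w v) (om u v)).

Let C (x : heis) : 'cV[{poly R}]_(n + n + 1) := map_mx polyC x.

Definition lifted_curve_poly : 'cV[{poly R}]_(n + n + 1) :=
  C g + 'X *: C (dleft g (vincl w)) + p *: C (dleft g (vincl u)) + q *: C (dleft g (vincl v))
  + zeta *: C (basisZ R n).

(** Horizontal curve issued from g, above the segment in direction w deformed by a
    closed loop in the plane of u and v. *)
Definition lifted_curve : R -> heis := curve_eval lifted_curve_poly.

Definition shadow t : 'cV[R]_(n + n) := t *: w + p.[t] *: u + q.[t] *: v.
Definition shadow_velocity t : 'cV[R]_(n + n) := w + p^`().[t] *: u + q^`().[t] *: v.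

Lemma shadow0 : shadow 0 = 0.
Proof.
have -> : shadow 0 = 0 *: w + 0 *: u + 0 *: v.
  by rewrite /shadow; congr (_ *: _ + _ *: _ + _ *: _); rewrite ?loop_oddE ?loop_evenE; ring.
by rewrite !scale0r !addr0.
Qed.

Lemma shadow1 : shadow 1 = w.
Proof.
have -> : shadow 1 = 1 *: w + 0 *: u + 0 *: v.
  by rewrite /shadow; congr (_ *: _ + _ *: _ + _ *: _); rewrite ?loop_oddE ?loop_evenE; ring.
by rewrite !scale0r !addr0 scale1r.
Qed.

Lemma left_mxM a b : left_mx a *m left_mx b = left_mx (a + b) :> 'M[R]_(n + n + 1).
Proof.
rewrite /left_mx mulmx_block !mul1mx !mulmx1 !mulmx0 !mul0mx !addr0 add0r.
by rewrite !linearD /= mulmxDl scalerDr.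
Qed.

Lemma dleft_comp (a b x : heis) : dleft a (dleft b x) = dleft (a + b) x.
Proof. by rewrite !dleftE mulmxA left_mxM. Qed.

Lemma dleft_basisZ (a : heis) : dleft a (basisZ R n) = basisZ R n.
Proof.
rewrite dleftE basisZE /left_mx mul_block_col.
by rewrite !mulmx0 !mul0mx !mul1mx !add0r.
Qed.

Lemma usubmx_basisZ : usubmx (basisZ R n) = 0.
Proof. by rewrite basisZE col_mxKu. Qed.

Lemma lifted_curveE t :
  lifted_curve t = g + dleft g (vincl (shadow t) + zeta.[t] *: basisZ R n).
Proof.
have -> : vincl (shadow t) = t *: vincl w + p.[t] *: vincl u + q.[t] *: vincl v.
  by rewrite /vincl !scale_col_mx !add_col_mx !scaler0 !addr0.
rewrite [in RHS]dleftE !mulmxDr -!scalemxAr -!dleftE.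
rewrite dleft_basisZ /lifted_curve /curve_eval /lifted_curve_poly /C.
move: (dleft g _) (dleft g _) (dleft g _) (basisZ R n) (p) (q) (zeta) => a b c d p0 q0 z0.
apply/matrixP => i j; rewrite !mxE !hornerD !hornerM !hornerC hornerX.
ring.
Qed.

Lemma derive1_lifted_curve t :
  derivable lifted_curve t 1 /\
  derive1 lifted_curve t = dleft g (vincl (shadow_velocity t) + zeta^`().[t] *: basisZ R n).
Proof.
have [dc ->] := curve_eval_derive lifted_curve_poly t; split=> //.
have -> : vincl (shadow_velocity t) = vincl w + p^`().[t] *: vincl u + q^`().[t] *: vincl v.
  by rewrite /vincl !scale_col_mx !add_col_mx !scaler0 !addr0.
rewrite [in RHS]dleftE !mulmxDr -!scalemxAr -!dleftE dleft_basisZ.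
rewrite /curve_eval /lifted_curve_poly /C.
move: (dleft g _) (dleft g _) (dleft g _) (basisZ R n) (p) (q) (zeta) => a b c d p0 q0 z0.
apply/matrixP => i j; rewrite !mxE !derivD !derivM !derivC derivX.
rewrite !hornerD !hornerM !hornerC !hornerX; ring.
Qed.

Lemma zeta_derive t :
  zeta^`().[t] = 2^-1 * om (shadow t) (shadow_velocity t).
Proof.
rewrite /shadow /shadow_velocity !(sympDl, sympDr, sympZl, sympZr) !symp_self.
rewrite (symp_skew w u) (symp_skew w v) (symp_skew u v) deriv_lift_heightE.
by congr (_ * _); ring.
Qed.

(** The vertical component is zero by the equation for the height. *)
Lemma lifted_velocity t : body_velocity lifted_curve t = vincl (shadow_velocity t).
Proof.
have [_ dE] := derive1_lifted_curve t; rewrite /body_velocity dE lifted_curveE /hinv.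
set X := _ + zeta^`().[t] *: _.
have uX : usubmx X = shadow_velocity t.
  by rewrite /X linearD linearZ /= usubmx_basisZ scaler0 addr0 /vincl col_mxKu.
rewrite dleft_comp.
set y := vincl (shadow t) + _.
have -> : - (g + dleft g y) + g = - dleft g y by rewrite opprD addrAC addNr add0r.
have uy : usubmx (- dleft g y) = - shadow t.
  rewrite linearN /= /dleft bracket_symp linearD !linearZ /= usubmx_basisZ !scaler0 addr0.
  by rewrite /y linearD linearZ /= usubmx_basisZ scaler0 addr0 /vincl col_mxKu.
rewrite {1}/dleft bracket_symp uX uy.
rewrite sympNl scaleNr scalerN scalerA -zeta_derive.
by rewrite /X addrK.
Qed.

End LiftedCurve.

(** * The lattice of horizontal parts, and horizontal displacement *)

Section Lattice.
Variables (R : realType) (n : nat) (r : 'I_n -> nat).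
Hypothesis r0 : forall i, (0 < r i)%N.
Local Notation heis := 'cV[R]_(n + n + 1).
Local Notation "z %:MR" := (map_mx (intr : int -> R) z) (at level 2, format "z %:MR").

Lemma usubmx_hmul (x y : heis) : usubmx (hmul x y) = usubmx x + usubmx y.
Proof.
by rewrite /hmul bracket_symp !linearD !linearZ /= usubmx_basisZ !scaler0 addr0.
Qed.

Definition dside (i : 'I_(n + n)) : R := row_mx (\row_(i < n) (r i)%:R) (const_mx 1) 0 i.

Lemma dsideX i : dside (lshift n i) = (r i)%:R.
Proof. by rewrite /dside row_mxEl mxE. Qed.

Lemma dsideY i : dside (rshift n i) = 1.
Proof. by rewrite /dside row_mxEr mxE. Qed.

Lemma dside_gt0 i : 0 < dside i.
Proof.
by case: (split_ordP i) => k ->; rewrite ?dsideX ?dsideY ?ltr01 ?ltr0n.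
Qed.

Lemma diagr_mul p (M : 'M[R]_(n + n, p)) i j : (diagr R r *m M) i j = dside i * M i j.
Proof. by rewrite /diagr mul_diag_mx mxE. Qed.

Lemma zlattice_sub u : zlattice r u -> exists z : 'cV[int]_(n + n), u = diagr R r *m z%:MR.
Proof.
move=> [x Gx <-]; pose P (x : heis) := exists z : 'cV[int]_(n + n), usubmx x = diagr R r *m z%:MR.
apply: (Gx P); split.
  split=> [|a b [z az] [z' bz]|a [z az]].
  - by exists 0; rewrite map_mx0 linear0 mulmx0.
  - by exists (z + z'); rewrite usubmx_hmul az bz map_mxD mulmxDr.
  - by exists (- z); rewrite /hinv linearN /= az map_mxN mulmxN.
have xE (i : 'I_(n + n)) (s : R) : s = dside i ->
    usubmx (s *: (delta_mx (lshift 1 i) 0 : heis)) =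
    diagr R r *m (delta_mx i 0 : 'cV[int]_(n + n))%:MR.
  move=> ->; apply/matrixP => k l; rewrite diagr_mul !mxE (inj_eq (@lshift_inj _ _)).
  by rewrite ord1 eqxx !andbT; case: eqVneq => [->|_] /=; rewrite ?mulr1z ?mulr0z ?mulr0 ?mulr1.
move=> _ [[[i _ <-]|[i _ <-]]|->].
- by exists (delta_mx (lshift n i) 0); apply: (xE (lshift n i)); rewrite dsideX.
- exists (delta_mx (rshift n i) 0); rewrite -(xE (rshift n i) 1) ?scale1r //.
  by rewrite dsideY.
- by exists 0; rewrite usubmx_basisZ map_mx0 mulmx0.
Qed.

(** The representative of a lattice point in the fundamental domain has a horizontal
    part that is both in the lattice and in a half-open box, hence zero. *)
Lemma zlattice_sup (z : 'cV[int]_(n + n)) : zlattice r (diagr R r *m z%:MR).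
Proof.
pose g : heis := vincl (diagr R r *m z%:MR).
have [y [[[yX [yY _]] [ga Gga hy]] _]] := fund_domainP r0 g.
have [z' z'E] : exists z' : 'cV[int]_(n + n), vproj ga = diagr R r *m z'%:MR.
  by apply: zlattice_sub; exists ga.
have uy : usubmx y = diagr R r *m (z' + z)%:MR.
  by rewrite -hy usubmx_hmul -/(vproj ga) z'E /g /vincl col_mxKu map_mxD mulmxDr.
have zz : z' + z = 0.
  apply/matrixP => i j; rewrite ord1 [RHS]mxE.
  have : 0 <= usubmx y i 0 < dside i.
    case: (split_ordP i) => k ->; rewrite mxE.
      by rewrite dsideX; exact: yX.
    by rewrite dsideY; exact: yY.
  rewrite uy diagr_mul mxE pmulr_rge0 ?dside_gt0 // -[X in _ < X]mulr1.
  rewrite ltr_pM2l ?dside_gt0 // ler0z -[X in _ < X]/(1%:~R) ltr_int.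
  by move: ((z' + z) i 0) => a; lia.
exists (hinv ga); first by have [_ _] := Gamma_subgroup R r; exact.
rewrite /hinv /vproj linearN /= -/(vproj ga) z'E -mulmxN -map_mxN.
by rewrite (addr0_eq zz).
Qed.

Lemma diagr_unit : diagr R r \in unitmx.
Proof.
rewrite unitmxE unitfE /diagr det_diag; apply/prodf_neq0 => i _.
by rewrite gt_eqF //; exact: dside_gt0.
Qed.

Lemma det_diagr : \det (diagr R r) = \prod_i (r i)%:R.
Proof.
rewrite /diagr det_diag big_split_ord /= [X in _ * X]big1 ?mulr1 => [|i _].
  by apply: eq_bigr => i _; exact: dsideX.
exact: dsideY.
Qed.

Lemma usubmx_scaleZ (s : R) : usubmx (s *: basisZ R n) = 0.
Proof. by rewrite linearZ /= usubmx_basisZ scaler0. Qed.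

Lemma bracketZr (x : heis) s : bracket x (s *: basisZ R n) = 0.
Proof. by rewrite bracket_symp usubmx_scaleZ symp0r scale0r. Qed.

Lemma Gamma_basisZ (k : int) : Gamma r (k%:~R *: basisZ R n).
Proof.
have [G0 GM GV] := Gamma_subgroup R r.
have GZ : Gamma r (basisZ R n) by apply: sub_gen_smallest; right.
have mulZ (s t : R) : hmul (s *: basisZ R n) (t *: basisZ R n) = (s + t) *: basisZ R n.
  by rewrite /hmul bracketZr scaler0 addr0 scalerDl.
have GZn (m : nat) : Gamma r (m%:R *: basisZ R n).
  elim: m => [|m IH]; first by rewrite scale0r.
  by rewrite -natr1 -mulZ; apply: GM => //; rewrite scale1r.
case: k => m; first exact: GZn.
by rewrite NegzE mulrNz scaleNr; apply: GV; exact: GZn.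
Qed.

Lemma horbit_translateZ (h y : heis) (k : int) :
  horbit r h y -> horbit r h (y + k%:~R *: basisZ R n).
Proof.
move=> [ga Gga <-]; have [_ GM _] := Gamma_subgroup R r.
exists (hmul ga (k%:~R *: basisZ R n)); first by apply: GM => //; exact: Gamma_basisZ.
rewrite /hmul bracketZr scaler0 addr0.
have -> : bracket (ga + k%:~R *: basisZ R n) h = bracket ga h.
  by rewrite !bracket_symp linearD /= usubmx_scaleZ addr0.
by rewrite -!addrA; congr (_ + _); rewrite addrC -!addrA; congr (_ + _); rewrite addrC.
Qed.

Lemma horbit_eq (h y : heis) : horbit r h y -> horbit r y = horbit r h.
Proof.
have [G0 GM GV] := Gamma_subgroup R r.
have hA (a b c : heis) : hmul (hmul a b) c = hmul a (hmul b c).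
  rewrite {1 3}/hmul !bracket_symp !usubmx_hmul sympDl sympDr /hmul !bracket_symp.
  move: (symp _ _) (symp _ _) (symp _ _) (basisZ R n) => s1 s2 s3 Z.
  by apply/matrixP => i j; rewrite !mxE; ring.
have hV (a b : heis) : hmul (hinv a) (hmul a b) = b.
  rewrite -hA; have -> : hmul (hinv a) a = 0.
    rewrite /hmul bracket_symp /hinv linearN /= sympNl symp_self oppr0.
    by rewrite scale0r scaler0 addr0 addNr.
  by rewrite /hmul bracket_symp linear0 symp0l scale0r scaler0 add0r addr0.
move=> [ga Gga <-]; apply/seteqP; split => x [de Gde <-].
  by rewrite -hA; exists (hmul de ga) => //; exact: GM.
exists (hmul de (hinv ga)); last by rewrite hA hV.
by apply: GM => //; exact: GV.
Qed.

End Lattice.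

Section PathsBelow.
Variables (R : realType) (n : nat).
Local Notation heis := 'cV[R]_(n + n + 1).
Implicit Types A : 'M[R]_(n + n).

Lemma scalA_sum A x : scalA A x x = \sum_i (invmx A *m x) i 0 ^+ 2.
Proof. by rewrite /scalA /dotprod; apply: eq_bigr => i _; rewrite expr2. Qed.

Lemma coord_le_normA A x i : `|(invmx A *m x) i 0| <= normA A x.
Proof.
rewrite -sqrtr_sqr /normA scalA_sum ler_wsqrtr // (bigD1 i) //= lerDl.
by apply: sumr_ge0 => k _; exact: sqr_ge0.
Qed.

Lemma coord_le_norm m (x : 'cV[R]_m) i : `|x i 0| <= `|x|.
Proof.
rewrite [leRHS]/Num.norm /= mx_normrE.
exact: (le_bigmax _ (fun ij : 'I_m * 'I_1 => `|x ij.1 ij.2|) (i, 0)).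
Qed.

Lemma vproj_dleft (a x : heis) : vproj (dleft a x) = vproj x.
Proof.
by rewrite /vproj /dleft bracket_symp linearD !linearZ /= usubmx_basisZ !scaler0 addr0.
Qed.

Lemma linear_functional_le m (L : 'rV[R]_m) :
  exists2 K, 0 < K & forall x : 'cV[R]_m, `|(L *m x) 0 0| <= K * `|x|.
Proof.
exists (1 + \sum_i `|L 0 i|).
  by rewrite ltr_pwDl // sumr_ge0.
move=> x; rewrite mxE mulrDl mul1r; apply: le_trans (ler_norm_sum _ _ _) _.
rewrite mulr_suml ler_wpDl //; apply: ler_sum => i _; rewrite normrM.
by rewrite ler_wpM2l // coord_le_norm.
Qed.

Lemma functional_AC01 (L : 'rV[R]_(n + n + 1)) (c : R -> heis) :
  abs_continuous01 c -> AC01 (fun t => (L *m c t) 0 0).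
Proof.
move=> acc e e0; have [K K0 HK] := linear_functional_le L.
have [del del0 H] := acc (e / K) (divr_gt0 e0 K0).
exists del => // m a b ab tr sm; have := H m a b ab tr sm.
rewrite ltr_pdivlMr // mulrC => h; apply: le_lt_trans h.
rewrite mulr_sumr; apply: ler_sum => i _; apply: le_trans (HK _).
by rewrite mulmxBr !mxE.
Qed.

Lemma functional_derive (L : 'rV[R]_(n + n + 1)) (c : R -> heis) t :
  derivable c t 1 -> derivable (fun s => (L *m c s) 0 0) t 1 /\
    derive1 (fun s => (L *m c s) 0 0) t = (L *m derive1 c t) 0 0.
Proof.
move=> dc; have dci i : derivable (fun s => c s i 0) t 1.
  by move/derivable_mxP: dc; apply.
have -> : (fun s => (L *m c s) 0 0) = \sum_i (fun s => L 0 i * c s i 0).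
  by apply/funext => s; rewrite mxE fct_sumE.
have dLi i : derivable (fun s => L 0 i * c s i 0) t 1 by apply: derivableZ.
split; first exact: derivable_sum.
rewrite derive1E derive_sum // mxE; apply: eq_bigr => i _.
rewrite (deriveZ (L 0 i) (dci i)) derive1E derive_mx // mxE //.
Qed.

(** Each orthonormal coordinate of the projection is absolutely continuous, and its
    derivative is at most the speed of the path in absolute value. *)
Lemma coord_displacement_le A (c : R -> heis) (D : R) i :
  horizontal c -> (path_length A c <= D%:E)%E ->
  `|(invmx A *m (vproj (c 1) - vproj (c 0))) i 0| <= D.
Proof.
move=> [acc hor] len.
pose L : 'rV[R]_(n + n + 1) := row i (row_mx (invmx A) 0).
have LE x : (L *m x) 0 0 = (invmx A *m vproj x) i 0.
  by rewrite /L -row_mul mxE -{1}(vsubmxK x) mul_row_col mul0mx addr0.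
have key (M : 'rV[R]_(n + n + 1)) : (forall x : heis, (M *m x) 0 0 <= `|(L *m x) 0 0|) ->
    (M *m c 1) 0 0 - (M *m c 0) 0 0 <= D.
  move=> ML; apply: (@AC01_increment_le R (fun t => (M *m c t) 0 0)
    (fun t => normA A (vproj (body_velocity c t))) D _ _ _ len).
  - exact: functional_AC01.
  - by move=> t; exact: sqrtr_ge0.
  apply: (@filterS _ _ (ae_filter_ringOfSetsType (@lebesgue_measure R)) _ _ _ hor)
    => t /= H t01; have [dc _] := H t01.
  have [d ->] := functional_derive M dc; split=> //.
  rewrite /body_velocity vproj_dleft; apply: le_trans (ML _) _.
  by rewrite LE coord_le_normA.
have -> : (invmx A *m (vproj (c 1) - vproj (c 0))) i 0 = (L *m c 1) 0 0 - (L *m c 0) 0 0.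
  by rewrite !LE mulmxBr !mxE.
have LN (x : heis) : ((- L) *m x) 0 0 = - (L *m x) 0 0 by rewrite mulNmx mxE.
rewrite ler_norml; apply/andP; split.
  rewrite lerNl opprB; have := key (- L); rewrite !LN opprK addrC; apply => x.
  by rewrite LN -normrN ler_norm.
by apply: key => x; exact: ler_norm.
Qed.

End PathsBelow.

(** * The diameter of the quotient *)

Section Diameter.
Variables (R : realType) (n : nat) (r : 'I_n -> nat).
Local Notation heis := 'cV[R]_(n + n + 1).
Implicit Types A : 'M[R]_(n + n).

Lemma zlatticeB (x y : 'cV[R]_(n + n)) : zlattice r x -> zlattice r y -> zlattice r (x - y).
Proof.
have [_ GM GV] := Gamma_subgroup R r.
move=> [a Ga <-] [b Gb <-]; exists (hmul a (hinv b)); first by apply: GM => //; exact: GV.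
by rewrite /vproj usubmx_hmul /hinv linearN.
Qed.

(** Lift a path of length less than D + 1 between the classes of 0 and of x, and
    project it: the endpoints are lattice translates of 0 and x. *)
Lemma covered_of_diam A D : (diam r A <= D%:E)%E ->
  forall x : 'cV[R]_(n + n), exists2 l, zlattice r l &
    forall i, `|(invmx A *m (x - l)) i 0| <= D + 1.
Proof.
move=> dD x.
have qd : (quotient_dist r A (horbit r 0) (horbit r (vincl x)) < (D + 1)%:E)%E.
  apply: (@le_lt_trans _ _ D%:E); last by rewrite lte_fin ltrDl.
  apply: le_trans dD; apply: ereal_sup_ubound; exists (horbit r 0); first by exists 0.
  by exists (horbit r (vincl x)) => //; exists (vincl x).
have [_ [c [hc c0 c1] <-] len] := ereal_inf_lt qd.
have [G0 _ _] := Gamma_subgroup R r.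
have hid (y : heis) : horbit r y y.
  by exists 0 => //; rewrite /hmul bracket_symp linear0 symp0l scale0r scaler0 add0r addr0.
have [a Ga aE] : horbit r 0 (c 0) by rewrite -c0; exact: hid.
have [b Gb bE] : horbit r (vincl x) (c 1) by rewrite -c1; exact: hid.
exists (vproj a - vproj b); first by apply: zlatticeB; [exists a|exists b].
move=> i; have := coord_displacement_le i hc (ltW len).
rewrite -aE -bE /vproj !usubmx_hmul /vincl col_mxKu linear0 addr0.
by rewrite opprB addrCA addrA addrC.
Qed.

Lemma central_part (x : heis) : usubmx x = 0 -> x = x (iZ n) 0 *: basisZ R n.
Proof.
move=> ux; rewrite basisZE scale_col_mx scaler0 -{1}(vsubmxK x) ux; congr col_mx.
by rewrite [LHS]mx11_scalar scale_scalar_mx mulr1; congr (_%:M); rewrite mxE.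
Qed.

Lemma lifted_curve_horizontal (g : heis) w u v : horizontal (lifted_curve g w u v).
Proof.
split.
  have [K K0 HK] := curve_eval_lipschitz (lifted_curve_poly g w u v).
  exact: lipschitz_abs_continuous K0 HK.
apply: aeW => t t01; split; first by have [] := derive1_lifted_curve g w u v t.
by rewrite lifted_velocity /vdistr /= /omega /vincl /iZ col_mxEd mxE.
Qed.

Lemma path_length_le A (c : R -> heis) (K : R) : 0 <= K ->
  (forall t, 0 <= t <= 1 -> normA A (vproj (body_velocity c t)) <= K) ->
  (path_length A c <= K%:E)%E.
Proof.
move=> K0 HK; rewrite /path_length.
have -> : K%:E = (\int[@lebesgue_measure R]_(t in `[0%R, 1%R]) (cst K%:E) t)%E.
  by rewrite integral_cst //= lebesgue_measure_itv /= lte_fin ltr01 -EFinD subr0 mule1.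
rewrite integral_mkcond [leRHS]integral_mkcond; apply: ge0_le_integral_nonmeas => t.
  by rewrite /patch; case: ifP => // _; rewrite lee_fin sqrtr_ge0.
rewrite /patch; case: ifPn => //; rewrite inE /= in_itv /= => t01.
by rewrite lee_fin HK.
Qed.

Lemma deriv_loop_odd_bound (t : R) : 0 <= t <= 1 -> (loop_odd R)^`().[t] ^+ 2 <= 1.
Proof.
move=> /andP[t0 t1]; rewrite deriv_loop_oddE.
have h : 0 <= t * (1 - t) <= 4^-1.
  by rewrite mulr_ge0 ?subr_ge0 //=; have := sqr_ge0 (t - 2^-1); lra.
have -> : 1 - 6 * t + 6 * t ^+ 2 = 1 - 6 * (t * (1 - t)) by ring.
move: (t * (1 - t)) h => s; nra.
Qed.

Lemma deriv_loop_even_bound (t : R) : 0 <= t <= 1 -> (loop_even R)^`().[t] ^+ 2 <= 4.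
Proof.
move=> /andP[t0 t1]; rewrite deriv_loop_evenE.
have h : 0 <= t * (1 - t) <= 4^-1.
  by rewrite mulr_ge0 ?subr_ge0 //=; have := sqr_ge0 (t - 2^-1); lra.
have -> : 1 - 12 * t + 30 * t ^+ 2 - 20 * t ^+ 3 = (1 - 2 * t) * (1 - 10 * (t * (1 - t))) by ring.
rewrite exprMn.
have h1 : (1 - 2 * t) ^+ 2 <= 1 by nra.
have h2 : (1 - 10 * (t * (1 - t))) ^+ 2 <= 4 by move: (t * (1 - t)) h => s; nra.
have := ler_pM (sqr_ge0 _) (sqr_ge0 _) h1 h2; lra.
Qed.

(** To go from g to the orbit of h, move along the horizontal vector w given by the
    covering bound, and correct the remaining height, in [0, 1] modulo the centre of
    the lattice, by a loop in the plane of two orthonormal vectors on which the form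
    is not small. *)
Lemma diam_le A D beta : A \in unitmx ->
  (forall x : 'cV[R]_(n + n), exists2 l, zlattice r l & scalA A (x - l) (x - l) <= D) ->
  0 < beta -> (exists i k, beta <= `|omega_mx A i k|) ->
  (diam r A <= (Num.sqrt (3 * (D + (70 / beta) ^+ 2 + 4)))%:E)%E.
Proof.
move=> uA cov b0 [i [k hik]]; apply: ge_ereal_sup.
move=> _ [_ [g _ <-] [_ [h _ <-] <-]].
have [_ [ga Gga <-] hl] := cov (vproj h - vproj g).
set w := _ - _ - _ in hl.
have [_ GM GV] := Gamma_subgroup R r.
pose y0 := hmul (hinv ga) h.
have y0h : horbit r h y0 by exists (hinv ga) => //; exact: GV.
pose b := omega_mx A i k.
have b0' : b != 0 by rewrite -normr_gt0 (lt_le_trans b0).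
pose s := (y0 - hmul g (vincl w)) (iZ n) 0.
pose m := Num.floor s.
pose s' := s - m%:~R.
have s'01 : 0 <= s' <= 1.
  by have := floor_itv s; rewrite intrD /s' /m => /andP[? ?]; apply/andP; split; lra.
(* The constant 70 compensates the area -1/70 enclosed by the loop. *)
pose u := - (70 * s' / b) *: col i A.
pose v := col k A.
have uv : symp u v = - (70 * s').
  rewrite /u sympZl; have -> : symp (col i A) v = b.
    by rewrite /symp /v tr_col -mulmxA mulmx_col -row_mul mulmx_col /b /omega_mx mulmxA !mxE.
  by field.
have end1 : lifted_curve g w u v 1 = y0 + (- m)%:~R *: basisZ R n.
  rewrite lifted_curveE lift_height1 uv opprK.
  rewrite shadow1 (_ : 70 * s' / 70 = s'); last by field.
  have -> : g + dleft g (vincl w + s' *: basisZ R n) = hmul g (vincl w) + s' *: basisZ R n.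
    rewrite dleftE mulmxDr -scalemxAr -!dleftE dleft_basisZ addrA; congr (_ + _).
    by rewrite /hmul /dleft addrA.
  have -> : y0 = hmul g (vincl w) + s *: basisZ R n.
    have /central_part dE : usubmx (y0 - hmul g (vincl w)) = 0.
      rewrite linearB /= !usubmx_hmul /hinv linearN /= /vincl col_mxKu /w /vproj.
      move: (usubmx ga) (usubmx h) (usubmx g) => x1 x2 x3.
      by apply/matrixP => a c; rewrite !mxE; ring.
    by rewrite /s -dE addrC subrK.
  by rewrite -[RHS]addrA -scalerDl rmorphN.
apply: (@le_trans _ _ (path_length A (lifted_curve g w u v))).
  apply: ereal_inf_lbound; exists (lifted_curve g w u v) => //; split.
  - exact: lifted_curve_horizontal.
  - rewrite lifted_curveE lift_height0 shadow0 scale0r addr0.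
    by rewrite /dleft bracket_symp /vincl col_mxKu symp0r scale0r scaler0 addr0 col_mx0 addr0.
  - by rewrite end1; apply: horbit_eq; exact: horbit_translateZ.
apply: path_length_le; first exact: sqrtr_ge0.
move=> t t01; rewrite lifted_velocity /vincl /vproj col_mxKu /normA ler_wsqrtr //.
have p1 := deriv_loop_odd_bound t01; have q1 := deriv_loop_even_bound t01.
set P := (loop_odd R)^`().[t] in p1; set Q := (loop_even R)^`().[t] in q1.
pose a := - (70 * s' / b).
have VE j : (invmx A *m shadow_velocity w u v t) j 0 =
    (invmx A *m w) j 0 + P * a * (j == i)%:R + Q * (j == k)%:R.
  rewrite /shadow_velocity -/P -/Q !mulmxDr /u -/a -!scalemxAr /v !mulmx_col mulVmx //.
  by rewrite scalerA !mxE.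
have a2 : a ^+ 2 <= (70 / beta) ^+ 2.
  rewrite /a sqrrN -[_ ^+ 2]real_normK ?num_real // ler_sqr ?nnegrE ?normr_ge0 //; last first.
    by rewrite divr_ge0 // ltW.
  rewrite normrM normfV (ger0_norm (_ : 0 <= 70 * s')); last by lra.
  apply: ler_pM; rewrite ?invr_ge0 ?normr_ge0 //; [lra|lra|].
  by rewrite lef_pV2 ?posrE ?normr_gt0.
have sumd c (l : 'I_(n + n)) : \sum_j (c * (j == l)%:R) ^+ 2 = c ^+ 2.
  rewrite (bigD1 l) //= eqxx mulr1 big1 ?addr0 // => j /negbTE ->.
  by rewrite mulr0 expr0n.
(* (x + y + z)^2 <= 3 (x^2 + y^2 + z^2), coordinatewise. *)
rewrite scalA_sum; apply: (@le_trans _ _ (3 * (\sum_j (invmx A *m w) j 0 ^+ 2 +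
   \sum_j (P * a * (j == i)%:R) ^+ 2 + \sum_j (Q * (j == k)%:R) ^+ 2))).
  rewrite -!big_split /= mulr_sumr; apply: ler_sum => j _; rewrite VE.
  move: ((invmx A *m w) j 0) (P * a * _) (Q * _) => x y z.
  have := sqr_ge0 (x - y); have := sqr_ge0 (x - z); have := sqr_ge0 (y - z).
  lra.
rewrite !sumd -scalA_sum ler_pM2l //; apply: lerD => //; apply: lerD => //.
rewrite exprMn; apply: le_trans a2; rewrite ler_piMl // sqr_ge0 //.
Qed.

End Diameter.

(** * Comparison of the two families of bounds *)

Lemma qform_gram (R : realType) m p (B : 'M[R]_(p, m)) y :
  qform (B^T *m B) y = \sum_i (B *m y) i 0 ^+ 2.
Proof.
rewrite /qform mulmxA -trmx_mul -mulmxA mxE; apply: eq_bigr => i _.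
by rewrite [X in X * _]mxE expr2.
Qed.

Section Comparison.
Variables (R : realType) (n : nat) (r : 'I_n -> nat).
Hypothesis n0 : (0 < n)%N.
Hypothesis r0 : forall i, (0 < r i)%N.
Implicit Types A : 'M[R]_(n + n).
Local Notation N := (n + n)%N.
Local Notation "z %:MR" := (map_mx (intr : int -> R) z) (at level 2, format "z %:MR").
Local Notation rprod := (\prod_i (r i)%:R : R).

(** Basis of the lattice in orthonormal coordinates. *)
Definition lattice_mx A : 'M[R]_(n + n) := invmx A *m diagr R r.

Let N0 : (0 < N)%N. Proof. by rewrite addn_gt0 n0. Qed.

Let rprod0 : 0 < rprod.
Proof. by apply: prodr_gt0 => i _; rewrite ltr0n. Qed.

Lemma normr_det_lattice_mx A : `|\det (lattice_mx A)| = rprod / `|\det A|.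
Proof.
rewrite /lattice_mx det_mulmx det_inv normrM normfV det_diagr mulrC.
by rewrite ger0_norm // ltW.
Qed.

Lemma lattice_mx_unit A : A \in unitmx -> lattice_mx A \in unitmx.
Proof. by move=> uA; rewrite unitmx_mul unitmx_inv uA diagr_unit. Qed.

Lemma normA_lattice A (z : 'cV[int]_(n + n)) :
  normA A (diagr R r *m z%:MR) = Num.sqrt (\sum_i (lattice_mx A *m z%:MR) i 0 ^+ 2).
Proof. by rewrite /normA scalA_sum /lattice_mx -mulmxA. Qed.

Lemma frob_entry (M : 'M[R]_(n + n)) i k : `|M i k| <= Num.sqrt (frob M).
Proof.
rewrite -sqrtr_sqr ler_wsqrtr // /frob (bigD1 i) //= (bigD1 k) //= -addrA lerDl.
by rewrite addr_ge0 ?sumr_ge0 // => j _; rewrite ?sqr_ge0 ?sumr_ge0 // => l _; rewrite sqr_ge0.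
Qed.

Lemma det_sqr_le A (K : R) : (forall i k, `|omega_mx A i k| <= K) ->
  `|\det A| ^+ 2 <= N`!%:R * K ^+ N.
Proof. by move=> h; rewrite -normr_det_omega_mx normr_det_le_exp. Qed.

Lemma le1Dsqr (x y : R) : 0 <= x -> x ^+ 2 <= y -> x <= 1 + y.
Proof. by move=> *; nra. Qed.

Lemma last_dtuple A d : A \in unitmx -> is_dtuple A d -> last 0 d <= Num.sqrt (frob (omega_mx A)).
Proof.
move=> uA hd; have := dtuple_sum_sqr uA hd; rewrite /frob => ->.
have ld : last 0 d \in val d.
  by case: d {hd} => -[|x s] /= /eqP sz; [exfalso; have := n0; rewrite -sz|rewrite mem_last].
rewrite (le_trans (ler_norm _)) // -sqrtr_sqr ler_wsqrtr //.
rewrite (big_rem _ ld) /=; have : 0 <= \sum_(y <- rem (last 0 d) d) y ^+ 2.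
  by apply: sumr_ge0 => i _; exact: sqr_ge0.
by have := sqr_ge0 (last 0 d); lra.
Qed.

(** The squared Frobenius norm is twice the sum of the squares of the d_k. *)
Lemma dtuple_frob_le A d C : is_dtuple A d -> A \in unitmx -> last 0 d <= C ->
  frob (omega_mx A) <= 2 * (n%:R * C ^+ 2).
Proof.
move=> hd uA dC; rewrite /frob (dtuple_sum_sqr uA hd) ler_pM2l //.
have [srt pos _] := hd.
have le x : x \in val d -> 0 <= x <= C.
  move=> xd; rewrite ltW ?(allP pos) //=; apply: le_trans dC.
  case/splitPr : xd srt => p1 p2.
  rewrite last_cat /=; rewrite (sorted_pairwise le_trans) pairwise_cat /= => /and3P[_ _ /andP[+ _]].
  by move=> /allP h; have := mem_last x p2; rewrite inE => /predU1P[->//|/h].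
have -> : n%:R * C ^+ 2 = \sum_(x <- d) C ^+ 2 :> R.
  by rewrite big_const_seq count_predT size_tuple iter_addr_0 mulr_natl.
rewrite big_seq [leRHS]big_seq; apply: ler_sum => x /le /andP[x0 xC].
by rewrite ler_sqr ?nnegrE // (le_trans x0).
Qed.

(** Up to sign the determinant of omega_mx A is the square of that of A; being a
    polynomial in the entries, it forbids them to be all small. *)
Lemma exists_large_entry A (C : R) : 0 < C -> C <= `|\det A| ->
  exists i k, Num.min 1 (C ^+ 2 / (2 * N`!%:R)) <= `|omega_mx A i k|.
Proof.
move=> C0 CA; set b := Num.min _ _; apply: contrapT => H.
have f0 : 0 < N`!%:R :> R by rewrite ltr0n fact_gt0.
have b0 : 0 < b by rewrite lt_min ltr01 divr_gt0 ?exprn_gt0 ?mulr_gt0.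
have hb i k : `|omega_mx A i k| <= b.
  by have [//|h] := leP (`|omega_mx A i k|) b; case: H; exists i, k; exact: ltW.
have b1 : b <= 1 by rewrite /b ge_min lexx.
have := det_sqr_le hb; have : b ^+ N <= b.
  by rewrite -[leRHS]expr1 ler_wiXn2l // ltW.
have : N`!%:R * b <= C ^+ 2 / 2.
  have : b <= C ^+ 2 / (2 * N`!%:R) by rewrite /b ge_min lexx orbT.
  rewrite ler_pdivlMr ?mulr_gt0 //; lra.
have C2 : C ^+ 2 <= `|\det A| ^+ 2 by rewrite ler_sqr ?nnegrE // ltW.
have : 0 < C ^+ 2 by rewrite exprn_gt0.
move=> h1 h2 h3 h4; have : N`!%:R * b ^+ N <= N`!%:R * b by rewrite ler_pM2l.
lra.
Qed.

(** The covolume of the lattice is the product of the r_i divided by |det A|. *)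
Lemma covered_of_lattice_bounds (C1 C2 : R) : 0 < C1 -> 0 < C2 -> exists D : R,
  forall A, A \in unitmx ->
    (forall l, zlattice r l -> l != 0 -> C1 <= normA A l) -> C2 <= `|\det A| ->
    forall x, exists2 l, zlattice r l & scalA A (x - l) (x - l) <= D.
Proof.
move=> C10 C20.
have [D HD] := covered_of_sep N ((rprod / C2) ^+ 2) (exprn_gt0 2 C10).
exists D => A uA short detA x; pose B := lattice_mx A.
have uB : B \in unitmx := lattice_mx_unit uA.
have qE := qform_gram B.
have pG : posdef (B^T *m B).
  split=> [|y y0]; first by rewrite trmx_mul trmxK.
  rewrite qE; have By : B *m y != 0.
    by apply: contraNneq y0 => h; rewrite -(mulKmx uB y) h mulmx0.
  rewrite lt_neqAle sumr_ge0 ?andbT; last by move=> i _; exact: sqr_ge0.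
  rewrite eq_sym psumr_eq0; last by move=> i _; exact: sqr_ge0.
  apply: contraNN By => /allP h; apply/eqP/matrixP => i j; rewrite ord1 [RHS]mxE.
  by have := h i (mem_index_enum _); rewrite sqrf_eq0 => /eqP.
have sep : lattice_sep (B^T *m B) (C1 ^+ 2).
  move=> z z0; rewrite qE.
  have : C1 <= normA A (diagr R r *m z%:MR).
    apply: short; first exact: zlattice_sup.
    have := mapR_neq0 R z0; apply: contraNneq => h.
    by rewrite -(mulKmx (diagr_unit R r0) z%:MR) h mulmx0.
  rewrite normA_lattice -/B => h; have s0 : 0 <= \sum_i (B *m z%:MR) i 0 ^+ 2.
    by apply: sumr_ge0 => i _; exact: sqr_ge0.
  by rewrite -(sqr_sqrtr s0) ler_sqr ?nnegrE ?sqrtr_ge0 // ltW.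
have detG : \det (B^T *m B) <= (rprod / C2) ^+ 2.
  rewrite det_mulmx det_tr -expr2 -[_ ^+ 2]real_normK ?num_real //.
  have rC : rprod / `|\det A| <= rprod / C2.
    by rewrite ler_pM2l // lef_pV2 ?posrE // (lt_le_trans C20).
  rewrite normr_det_lattice_mx lerXn2r // nnegrE divr_ge0 // ltW //.
have [z hz] := HD _ pG sep detG (invmx (diagr R r) *m x).
exists (diagr R r *m z%:MR); first exact: zlattice_sup.
move: hz; rewrite qE scalA_sum /B /lattice_mx -mulmxA mulmxBr mulKVmx //.
exact: diagr_unit.
Qed.

(** The total measure is the product of the r_i over |det A| times the Frobenius norm
    of omega_mx A, and both factors are controlled by d_n. *)
Lemma diam_meas_of_lattice (C1 C2 C3 : R) : 0 < C1 -> 0 < C2 -> 0 < C3 ->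
  exists D V : R, [/\ 0 < D, 0 < V & forall A, A \in unitmx ->
     (forall l, zlattice r l -> l != 0 -> C1 <= normA A l) -> C2 <= `|\det A| ->
     (exists2 d, is_dtuple A d & last 0 d <= C3) ->
     (diam r A <= D%:E)%E /\ V <= popp_total r A].
Proof.
move=> C10 C20 C30; have [D0 cov] := covered_of_lattice_bounds C10 C20.
pose b := Num.min 1 (C2 ^+ 2 / (2 * N`!%:R)) : R.
have f0 : 0 < N`!%:R :> R by rewrite ltr0n fact_gt0.
have b0 : 0 < b by rewrite lt_min ltr01 divr_gt0 ?exprn_gt0 ?mulr_gt0.
pose K : R := 1 + 2 * (n%:R * C3 ^+ 2).
have K0 : 0 < K by rewrite ltr_pwDl // mulr_ge0 // mulr_ge0 // sqr_ge0.
pose M : R := 1 + N`!%:R * K ^+ N.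
have M0 : 0 < M by rewrite ltr_pwDl // mulr_ge0 // ?exprn_ge0 // ltW.
exists (Num.sqrt (3 * (D0 + (70 / b) ^+ 2 + 4)) + 1), ((K * M)^-1 * rprod); split.
- by rewrite ltr_wpDl // sqrtr_ge0.
- by rewrite mulr_gt0 // invr_gt0 mulr_gt0.
move=> A uA short detA [d hd dC].
have [i [k hik]] := exists_large_entry C20 detA.
have sK : Num.sqrt (frob (omega_mx A)) <= K.
  apply: le1Dsqr; first exact: sqrtr_ge0.
  by rewrite sqr_sqrtr ?frob_ge0 //; exact: dtuple_frob_le dC.
have s0 : 0 < Num.sqrt (frob (omega_mx A)).
  by apply: lt_le_trans b0 _; apply: le_trans hik _; exact: frob_entry.
have a0 : 0 < `|\det A| by exact: lt_le_trans detA.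
have aM : `|\det A| <= M.
  apply: le1Dsqr => //; apply: det_sqr_le => j l; apply: le_trans sK; exact: frob_entry.
split.
  apply: le_trans (diam_le uA (cov A uA short detA) b0 _) _; first by exists i, k.
  by rewrite lee_fin lerDl.
rewrite /popp_total ler_pM2r // lef_pV2 ?posrE ?mulr_gt0 //.
by apply: ler_pM => //; exact: ltW.
Qed.

(** A covering bound gives a lower bound for |det A|; then the measure bounds the
    Frobenius norm, hence d_n, from above, and hence |det A| as well. The covolume is
    then bounded from below, and so is the shortest vector. *)
Lemma lattice_of_diam_meas (D V : R) : 0 < D -> 0 < V ->
  exists C1 C2 C3 : R, [/\ 0 < C1, 0 < C2, 0 < C3 & forall A, A \in unitmx ->
     (diam r A <= D%:E)%E -> V <= popp_total r A ->
     [/\ exists2 m, is_minimum (normA A @` (zlattice r `\ 0)) m & C1 <= m,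
           C2 <= `|\det A| & exists2 d, is_dtuple A d & last 0 d <= C3]].
Proof.
move=> D0 V0; pose E := D + 1; have E0 : 0 < E by rewrite addr_gt0.
have f0 : 0 < N`!%:R :> R by rewrite ltr0n fact_gt0.
pose K : R := N.+2%:R * E; have K0 : 0 < K by rewrite mulr_gt0.
pose C2 := rprod / (N`!%:R * K ^+ N).
have C20 : 0 < C2 by rewrite divr_gt0 // mulr_gt0 // exprn_gt0.
pose C3 := rprod / (V * C2).
have C30 : 0 < C3 by rewrite divr_gt0 // mulr_gt0.
pose M : R := 1 + N`!%:R * C3 ^+ N.
have M0 : 0 < M by rewrite ltr_pwDl // mulr_ge0 // ?exprn_ge0 // ltW.
pose C1 := (rprod / M) / (N`!%:R * K ^+ N.-1).
have C10 : 0 < C1 by rewrite !divr_gt0 // mulr_gt0 // exprn_gt0.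
exists C1, C2, C3; split=> // A uA dD VA; pose B := lattice_mx A.
have uB : B \in unitmx := lattice_mx_unit uA.
have a0 : 0 < `|\det A| by rewrite normr_gt0 -unitfE -unitmxE.
have cov (y : 'cV[R]_(n + n)) : exists z : 'cV[int]_(n + n),
    forall i, `|(y - B *m z%:MR) i 0| <= E.
  have [l /zlattice_sub[z ->] hz] := covered_of_diam dD (A *m y).
  by exists z => i; have := hz i; rewrite mulmxBr mulKmx // mulmxA.
have detA : C2 <= `|\det A|.
  have := covered_det_le E0 cov; rewrite normr_det_lattice_mx -/K.
  rewrite ler_pdivrMr // /C2 ler_pdivrMr ?mulr_gt0 ?exprn_gt0 //.
  by rewrite mulrC.
have s0 := sqrtr_ge0 (frob (omega_mx A)).
have sC : Num.sqrt (frob (omega_mx A)) <= C3.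
  move: VA; rewrite /popp_total; set s := Num.sqrt _ in s0 *.
  have [->|sn0] := eqVneq s 0; first by move=> _; rewrite ltW.
  have sa0 : 0 < s * `|\det A| by rewrite mulr_gt0 // lt_neqAle eq_sym sn0.
  rewrite mulrC ler_pdivlMr // => h; rewrite /C3 ler_pdivlMr; last exact: mulr_gt0.
  apply: le_trans h; rewrite mulrCA ler_pM2l // ler_wpM2l //.
have [d hd] := dtuple_exists uA.
have aM : `|\det A| <= M.
  apply: le1Dsqr => //; apply: det_sqr_le => j l; apply: le_trans sC; exact: frob_entry.
split=> //; last by exists d => //; apply: le_trans sC; exact: last_dtuple.
have [z0 z00 zmin] := lattice_shortest N0 uB.
exists (normA A (diagr R r *m z0%:MR)).
  split.
    exists (diagr R r *m z0%:MR) => //; split; first exact: zlattice_sup.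
    move=> /= h; have := mapR_neq0 R z00.
    by rewrite -(mulKmx (diagr_unit R r0) z0%:MR) h mulmx0 eqxx.
  move=> _ [l [/zlattice_sub[z ->] l0] <-]; rewrite !normA_lattice ler_wsqrtr //.
  apply: zmin; apply: contra_notN l0 => /eqP ->.
  by rewrite /= map_mx0 mulmx0.
have Bz0 : B *m z0%:MR != 0.
  by have := mapR_neq0 R z00; apply: contraNneq => h; rewrite -(mulKmx uB z0%:MR) h mulmx0.
have hx i : `|(B *m z0%:MR) i 0| <= normA A (diagr R r *m z0%:MR).
  by have := coord_le_normA A (diagr R r *m z0%:MR) i; rewrite mulmxA.
have := covered_short_vector E0 cov Bz0 hx.
rewrite -/K normr_det_lattice_mx => h; rewrite /C1 ler_pdivrMr ?mulr_gt0 ?exprn_gt0 //.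
rewrite mulrCA; apply: le_trans h; rewrite ler_pM2l //.
by rewrite lef_pV2 ?posrE.
Qed.

End Comparison.

Theorem proposition1p4 (R : realType) (n : nat) (hn : (0 < n)%N)
    (r : 'I_n -> nat) (hr : Dtuple r)
    (X : set (set 'M[R]_(n + n + 1))) (hX : X `<=` moduli r) :
  (exists C1 C2 C3 : R, [/\ 0 < C1, 0 < C2, 0 < C3 &
     forall A : 'M[R]_(n + n), A \in unitmx ->
       X (moduli_class r (block_mx A 0 0 0)) ->
       [/\ exists2 m, is_minimum (normA A @` (zlattice r `\ 0)) m & C1 <= m,
           C2 <= `|\det A|
         & exists2 d, is_dtuple A d & last 0 d <= C3]])
  <->
  (exists D V : R, [/\ 0 < D, 0 < V &
     forall A : 'M[R]_(n + n), A \in unitmx ->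
       X (moduli_class r (block_mx A 0 0 0)) ->
       (diam r A <= D%:E)%E /\
       (exists2 m, is_popp_meas r A m & (V%:E <= m)%E)]).
Proof.
have [r0 _] := hr; split.
  move=> [C1 [C2 [C3 [C10 C20 C30 H]]]].
  have [D [V [D0 V0 HDV]]] := diam_meas_of_lattice hn r0 C10 C20 C30.
  exists D, V; split=> // A uA XA; have [[m [_ mlb] C1m] detA hd] := H A uA XA.
  have short l : zlattice r l -> l != 0 -> C1 <= normA A l.
    move=> zl l0; apply: le_trans C1m _; apply: mlb; exists l => //.
    by split=> // /= l00; rewrite l00 eqxx in l0.
  have [dD VA] := HDV A uA short detA hd; split=> //.
  by exists (popp_total r A)%:E; [exact: is_popp_meas_exists|rewrite lee_fin].
move=> [D [V [D0 V0 H]]].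
have [C1 [C2 [C3 [C10 C20 C30 HC]]]] := lattice_of_diam_meas hn r0 D0 V0.
exists C1, C2, C3; split=> // A uA XA; have [dD [m hm Vm]] := H A uA XA.
by apply: HC => //; rewrite -lee_fin -(is_popp_meas_val uA hm).
Qed.
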